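(* Let $k$ be a field, let $\mathcal{C}_1$ and $\mathcal{C}_2$ be two small $k$-linear categories, let $M$ be a $\mathcal{C}_1$-$\mathcal{C}_2$-bimodule, and put $\mathcal{C}=\mathcal{C}_1\sqcup_M\mathcal{C}_2$. For every $\mathcal{C}$-bimodule $N$ there is a cohomological long exact sequence $$0\to H^0(\mathcal{C},N)\to H^0(\mathcal{C}_1,r_1(N))\oplus H^0(\mathcal{C}_2,r_2(N))\to\mathrm{Hom}_{\mathcal{C}_1\boxtimes\mathcal{C}_2^{op}}(M,r_{1,2}(N))\to H^1(\mathcal{C},N)\to\cdots$$ $$\cdots\to H^n(\mathcal{C},N)\to H^n(\mathcal{C}_1,r_1(N))\oplus H^n(\mathcal{C}_2,r_2(N))\to\mathrm{Ext}^n_{\mathcal{C}_1\boxtimes\mathcal{C}_2^{op}}(M,r_{1,2}(N))\to H^{n+1}(\mathcal{C},N)\to\cdots$$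
   Context: A small category $\mathcal{C}$ with object set $\mathcal{C}_0$ is $k$-linear if each set ${}_y\mathcal{C}_x$ of morphisms from $x$ to $y$ is a $k$-vector space and composition ${}_z\mathcal{C}_y\otimes_k{}_y\mathcal{C}_x\to{}_z\mathcal{C}_x$ is $k$-bilinear. A left $\mathcal{C}$-module is a covariant $k$-linear functor from $\mathcal{C}$ to $k$-vector spaces. For $k$-linear categories $\mathcal{A},\mathcal{B}$, the category $\mathcal{A}\boxtimes\mathcal{B}$ has object set $\mathcal{A}_0\times\mathcal{B}_0$ and morphisms ${}_{(a',b')}(\mathcal{A}\boxtimes\mathcal{B})_{(a,b)}={}_{a'}\mathcal{A}_a\otimes_k{}_{b'}\mathcal{B}_b$. An $\mathcal{A}$-$\mathcal{B}$-bimodule is a left $\mathcal{A}\boxtimes\mathcal{B}^{op}$-module, i.e. a family of $k$-vector spaces ${}_aM_b$ ($a\in\mathcal{A}_0$, $b\in\mathcal{B}_0$) with compatible left $\mathcal{A}$-action ${}_{a'}\mathcal{A}_a\otimes_k{}_aM_b\to{}_{a'}M_b$ and right $\mathcal{B}$-action ${}_aM_b\otimes_k{}_b\mathcal{B}_{b'}\to{}_aM_{b'}$. A $\mathcal{C}$-bimodule is a $\mathcal{C}$-$\mathcal{C}$-bimodule. The category $\mathcal{C}=\mathcal{C}_1\sqcup_M\mathcal{C}_2$ has object set $(\mathcal{C}_1)_0\sqcup(\mathcal{C}_2)_0$ and morphisms ${}_x\mathcal{C}_y={}_x(\mathcal{C}_1)_y$ for $x,y\in(\mathcal{C}_1)_0$;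 ${}_x\mathcal{C}_y={}_x(\mathcal{C}_2)_y$ for $x,y\in(\mathcal{C}_2)_0$; ${}_x\mathcal{C}_y={}_xM_y$ for $x\in(\mathcal{C}_1)_0$, $y\in(\mathcal{C}_2)_0$; and ${}_x\mathcal{C}_y=0$ otherwise; composition is given by the compositions of $\mathcal{C}_1$, $\mathcal{C}_2$ and the actions on $M$. For a $\mathcal{C}$-bimodule $N$ and $i,j\in\{1,2\}$, $r_{i,j}(N)$ is the $\mathcal{C}_i$-$\mathcal{C}_j$-bimodule obtained by restricting $N$, i.e. ${}_xr_{i,j}(N)_y={}_xN_y$ for $x\in(\mathcal{C}_i)_0$, $y\in(\mathcal{C}_j)_0$; and $r_i(N)=r_{i,i}(N)$. Hochschild-Mitchell cohomology $H^\bullet(\mathcal{A},N)$ of a small $k$-linear category $\mathcal{A}$ with coefficients in an $\mathcal{A}$-bimodule $N$ is the cohomology of the complex $$C^n(\mathcal{A},N)=\prod_{(x_1,\dots,x_{n+1})\in\mathcal{A}_0^{n+1}}\mathrm{Hom}_k({}_{x_{n+1}}\mathcal{A}_{x_n}\otimes_k\dots\otimes_k{}_{x_2}\mathcal{A}_{x_1},\ {}_{x_{n+1}}N_{x_1}),\qquad C^0(\mathcal{A},N)=\prod_x{}_xN_x,$$ with differential $(d\varphi)(f_1\otimes\dots\otimes f_{n+1})=f_1\varphi(f_2\otimes\dots\otimes f_{n+1})+\sum_{i=1}^{n}(-1)^i\varphi(f_1\otimes\dots\otimes f_if_{i+1}\otimes\dots\otimes f_{n+1})+(-1)^{n+1}\varphi(f_1\otimes\dots\otimes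 f_n)f_{n+1}$. *)

(* Defs.v *)
From HB Require Import structures.
From mathcomp Require Import all_boot all_order all_algebra.
From mathcomp Require Import generic_quotient ring_quotient.
From mathcomp Require Import boolp.

Set Implicit Arguments.
Unset Strict Implicit.
Unset Printing Implicit Defensive.

Import GRing.Theory.

Local Open Scope ring_scope.
Local Open Scope quotient_scope.

Record cochain_complex (k : fieldType) := CochainComplex {
  cterm :> nat -> lmodType k;
  cdiff : forall n, {linear cterm n -> cterm n.+1};
  cdiffK : forall n (x : cterm n), cdiff n.+1 (cdiff n x) = 0
}.
Arguments cdiff {k} _ n.

Section Cohomology.
Context (k : fieldType) (K : cochain_complex k) (n : nat).

Definition cocycle_pred : pred (K n) := [pred x | cdiff K n x == 0].

Fact cocycle_pred_closed : submod_closed cocycle_pred.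
Proof.
split=> [|a x y]; rewrite !inE ?linear0 // => /eqP dx /eqP dy.
by rewrite linearP dx dy scaler0 addr0.
Qed.
HB.instance Definition _ :=
  GRing.isSubmodClosed.Build k (K n) cocycle_pred cocycle_pred_closed.

Record cocycle := Cocycle {
  cocycle_val :> K n;
  cocycle_valP : cocycle_val \in cocycle_pred }.

HB.instance Definition _ := [isSub for cocycle_val].
HB.instance Definition _ := [Choice of cocycle by <:].
HB.instance Definition _ := [SubChoice_isSubZmodule of cocycle by <:].
HB.instance Definition _ := [SubZmodule_isSubLmodule of cocycle by <:].

Definition is_coboundary : K n -> Prop :=
  match n return K n -> Prop with
  | 0 => fun x => x = 0
  | m.+1 => fun x => exists y : K m, x = cdiff K m y
  end.

Definition coboundary : pred cocycle := [pred z : cocycle | `[< is_coboundary (z : K n) >]].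

Fact is_coboundary_closed (a : k) (x y : K n) :
  is_coboundary x -> is_coboundary y -> is_coboundary (a *: x + y).
Proof.
rewrite /is_coboundary; case: n x y => [|m] x y.
  by move=> -> ->; rewrite scaler0 addr0.
by move=> [u ->] [v ->]; exists (a *: u + v); rewrite linearP.
Qed.

Fact coboundary_closed : submod_closed coboundary.
Proof.
split=> [|a x y]; rewrite !inE.
  apply/asboolP; change (is_coboundary (0 : K n)).
  by rewrite /is_coboundary; case: n => // m; exists 0; rewrite linear0.
move=> /asboolP xP /asboolP yP; apply/asboolP.
change (is_coboundary (a *: (x : K n) + (y : K n))).
exact: is_coboundary_closed.
Qed.
HB.instance Definition _ :=
  GRing.isSubmodClosed.Build k cocycle coboundary coboundary_closed.

Definition cohomology := 
  Quotient.quot (GRing.ZmodClosed.clone cocycle coboundary _).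
HB.instance Definition _ := ZmodQuotient.on cohomology.

Definition cohomology_scale (a : k) := lift_op1 cohomology ( *:%R a).

Fact pi_cohomology_scale a :
  {morph \pi_cohomology : x / a *: x >-> cohomology_scale a x}.
Proof.
move=> x; unlock cohomology_scale; apply/eqP; rewrite -Quotient.idealrBE -scalerBr.
by rewrite rpredZ // Quotient.idealrBE reprK.
Qed.
Canonical pi_cohomology_scale_morph a := PiMorph1 (pi_cohomology_scale a).

Fact cohomology_scaleA (a b : k) (u : cohomology) :
  cohomology_scale a (cohomology_scale b u) = cohomology_scale (a * b) u.
Proof. by rewrite -[u]reprK !piE scalerA. Qed.

Fact cohomology_scale1 : left_id 1 cohomology_scale.
Proof. by move=> u; rewrite -[u]reprK !piE scale1r. Qed.

Fact cohomology_scaleDr : right_distributive cohomology_scale +%R.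
Proof. by move=> a u v; rewrite -[u]reprK -[v]reprK !piE scalerDr. Qed.

Fact cohomology_scaleDl (u : cohomology) :
  {morph cohomology_scale^~ u : a b / a + b}.
Proof. by move=> a b; rewrite -[u]reprK !piE scalerDl. Qed.

HB.instance Definition _ := GRing.Zmodule_isLmodule.Build k cohomology
  cohomology_scaleA cohomology_scale1 cohomology_scaleDr cohomology_scaleDl.

End Cohomology.

Fact linear_fun0 (k : fieldType) (U V : lmodType k) (f : U -> V) :
  linear f -> f 0 = 0.
Proof. by move=> /(_ (-1) 0 0); rewrite scaler0 addr0 scaleN1r addNr. Qed.

(* As in {}_y C_x, [hom C y x] is the space of morphisms from x to y: the target
   comes first. *)

Record linear_category (k : fieldType) := LinearCategory {
  obj :> Type;
  hom : obj -> obj -> lmodType k;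
  idm : forall x, hom x x;
  comp : forall z y x, hom z y -> hom y x -> hom z x;
  comp_linearl : forall z y x (g : hom y x), linear (fun f : hom z y => comp f g);
  comp_linearr : forall z y x (f : hom z y), linear (fun g : hom y x => comp f g);
  comp1m : forall y x (f : hom y x), comp (idm y) f = f;
  compm1 : forall y x (f : hom y x), comp f (idm x) = f;
  compA : forall z y x w (f : hom z y) (g : hom y x) (h : hom x w),
    comp f (comp g h) = comp (comp f g) h
}.
Arguments hom {k} _ _ _.
Arguments idm {k _} _.
Arguments comp {k _ z y x}.

Record linear_functor (k : fieldType) (A B : linear_category k) := LinearFunctor {
  fobj :> A -> B;
  fmap : forall y x, hom A y x -> hom B (fobj y) (fobj x);
  fmap_linear : forall y x, linear (@fmap y x);
  fmap1 : forall x, fmap (idm x) = idm (fobj x);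
  fmapM : forall z y x (f : hom A z y) (g : hom A y x),
    fmap (comp f g) = comp (fmap f) (fmap g)
}.
Arguments fmap {k A B} _ {y x}.

(* A left A \boxtimes B^op-module, in terms of the two commuting actions. *)
Record bimodule (k : fieldType) (A B : linear_category k) := Bimodule {
  bcar :> A -> B -> lmodType k;
  lact : forall a' a b, hom A a' a -> bcar a b -> bcar a' b;
  ract : forall a b b', bcar a b -> hom B b b' -> bcar a b';
  lact_linearl : forall a' a b (m : bcar a b), linear (fun f : hom A a' a => lact f m);
  lact_linearr : forall a' a b (f : hom A a' a), linear (fun m : bcar a b => lact f m);
  ract_linearl : forall a b b' (g : hom B b b'), linear (fun m : bcar a b => ract m g);
  ract_linearr : forall a b b' (m : bcar a b), linear (fun g : hom B b b' => ract m g);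
  lact1 : forall a b (m : bcar a b), lact (idm a) m = m;
  ract1 : forall a b (m : bcar a b), ract m (idm b) = m;
  lactA : forall a'' a' a b (f : hom A a'' a') (g : hom A a' a) (m : bcar a b),
    lact (comp f g) m = lact f (lact g m);
  ractA : forall a b b' b'' (m : bcar a b) (f : hom B b b') (g : hom B b' b''),
    ract m (comp f g) = ract (ract m f) g;
  lractA : forall a' a b b' (f : hom A a' a) (m : bcar a b) (g : hom B b b'),
    ract (lact f m) g = lact f (ract m g)
}.
Arguments lact {k A B} _ {a' a b}.
Arguments ract {k A B} _ {a b b'}.

Section Zeros.
Context (k : fieldType) (A B : linear_category k) (N : bimodule A B).

Fact comp0m (z y x : A) (g : hom A y x) : comp (0 : hom A z y) g = 0.
Proof. exact: (linear_fun0 (comp_linearl g)). Qed.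

Fact compm0 (z y x : A) (f : hom A z y) : comp f (0 : hom A y x) = 0.
Proof. exact: (linear_fun0 (comp_linearr f)). Qed.

Fact lact0m (a' a : A) (b : B) (m : N a b) : lact N (0 : hom A a' a) m = 0.
Proof. exact: (linear_fun0 (lact_linearl m)). Qed.

Fact lactm0 (a' a : A) (b : B) (f : hom A a' a) : lact N f (0 : N a b) = 0.
Proof. exact: (linear_fun0 (lact_linearr f)). Qed.

Fact ract0m (a : A) (b b' : B) (g : hom B b b') : ract N (0 : N a b) g = 0.
Proof. exact: (linear_fun0 (ract_linearl g)). Qed.

Fact ractm0 (a : A) (b b' : B) (m : N a b) : ract N m (0 : hom B b b') = 0.
Proof. exact: (linear_fun0 (ract_linearr m)). Qed.

End Zeros.

Section Restriction.
Context (k : fieldType) (A B A' B' : linear_category k).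
Context (F : linear_functor A' A) (G : linear_functor B' B) (N : bimodule A B).

Let rlact a' a b (f : hom A' a' a) (m : N (F a) (G b)) := lact N (fmap F f) m.
Let rract a b b' (m : N (F a) (G b)) (g : hom B' b b') := ract N m (fmap G g).

Fact restr_lact_linearl a' a b (m : N (F a) (G b)) :
  linear (fun f : hom A' a' a => rlact f m).
Proof. by move=> c f g; rewrite /rlact fmap_linear lact_linearl. Qed.
Fact restr_lact_linearr a' a b (f : hom A' a' a) : linear (@rlact a' a b f).
Proof. by move=> c m n; rewrite /rlact lact_linearr. Qed.
Fact restr_ract_linearl a b b' (g : hom B' b b') :
  linear (fun m : N (F a) (G b) => rract m g).
Proof. by move=> c m n; rewrite /rract ract_linearl. Qed.
Fact restr_ract_linearr a b b' (m : N (F a) (G b)) : linear (@rract a b b' m).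
Proof. by move=> c f g; rewrite /rract fmap_linear ract_linearr. Qed.
Fact restr_lact1 a b (m : N (F a) (G b)) : rlact (idm a) m = m.
Proof. by rewrite /rlact fmap1 lact1. Qed.
Fact restr_ract1 a b (m : N (F a) (G b)) : rract m (idm b) = m.
Proof. by rewrite /rract fmap1 ract1. Qed.
Fact restr_lactA a'' a' a b (f : hom A' a'' a') (g : hom A' a' a)
  (m : N (F a) (G b)) : rlact (comp f g) m = rlact f (rlact g m).
Proof. by rewrite /rlact fmapM lactA. Qed.
Fact restr_ractA a b b' b'' (m : N (F a) (G b)) (f : hom B' b b')
  (g : hom B' b' b'') : rract m (comp f g) = rract (rract m f) g.
Proof. by rewrite /rract fmapM ractA. Qed.
Fact restr_lractA a' a b b' (f : hom A' a' a) (m : N (F a) (G b))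
  (g : hom B' b b') : rract (rlact f m) g = rlact f (rract m g).
Proof. exact: lractA. Qed.

Definition restriction : bimodule A' B' :=
  @Bimodule k A' B' (fun a b => N (F a) (G b)) rlact rract
    restr_lact_linearl restr_lact_linearr restr_ract_linearl restr_ract_linearr
    restr_lact1 restr_ract1 restr_lactA restr_ractA restr_lractA.

End Restriction.

Section Gluing.
Context (k : fieldType) (C1 C2 : linear_category k) (M : bimodule C1 C2).

Definition glue_hom (y x : C1 + C2) : lmodType k :=
  match y, x with
  | inl y1, inl x1 => hom C1 y1 x1
  | inr y2, inr x2 => hom C2 y2 x2
  | inl y1, inr x2 => M y1 x2
  | inr _, inl _ => 'rV[k]_0
  end.

Definition glue_id (x : C1 + C2) : glue_hom x x :=
  match x with inl x1 => idm x1 | inr x2 => idm x2 end.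

Definition glue_comp (z y x : C1 + C2) :
    glue_hom z y -> glue_hom y x -> glue_hom z x :=
  match z, y, x return glue_hom z y -> glue_hom y x -> glue_hom z x with
  | inl _, inl _, inl _ => fun f g => comp f g
  | inl _, inl _, inr _ => fun f m => lact M f m
  | inl _, inr _, inr _ => fun m g => ract M m g
  | inr _, inr _, inr _ => fun f g => comp f g
  | _, _, _ => fun _ _ => 0
  end.

Fact glue_comp_linearl z y x (g : glue_hom y x) :
  linear (fun f : glue_hom z y => glue_comp f g).
Proof.
case: z y x g => z [] y [] x g c f f' /=; rewrite ?scaler0 ?addr0 //.
- exact: (comp_linearl g c f f').
- exact: (lact_linearl g c f f').
- exact: (ract_linearl g c f f').
- exact: (comp_linearl g c f f').
Qed.

Fact glue_comp_linearr z y x (f : glue_hom z y) : linear (@glue_comp z y x f).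
Proof.
case: z y x f => z [] y [] x f c g g' /=; rewrite ?scaler0 ?addr0 //.
- exact: (comp_linearr f c g g').
- exact: (lact_linearr f c g g').
- exact: (ract_linearr f c g g').
- exact: (comp_linearr f c g g').
Qed.

Fact glue_comp1m y x (f : glue_hom y x) : glue_comp (glue_id y) f = f.
Proof.
by case: y x f => y [] x f /=; rewrite ?comp1m ?lact1 //; apply/rowP; case.
Qed.

Fact glue_compm1 y x (f : glue_hom y x) : glue_comp f (glue_id x) = f.
Proof.
by case: y x f => y [] x f /=; rewrite ?compm1 ?ract1 //; apply/rowP; case.
Qed.

Fact glue_compA z y x w (f : glue_hom z y) (g : glue_hom y x) (h : glue_hom x w) :
  glue_comp f (glue_comp g h) = glue_comp (glue_comp f g) h.
Proof.
by case: z y x w f g h => z [] y [] x [] w f g h //=;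
  rewrite ?lactA ?ractA ?lractA ?compA ?lactm0 ?lact0m ?ractm0 ?ract0m ?comp0m
          ?compm0.
Qed.

(* C1 \sqcup_M C2 *)
Definition gluing : linear_category k :=
  @LinearCategory k (C1 + C2)%type glue_hom glue_id glue_comp
    glue_comp_linearl glue_comp_linearr glue_comp1m glue_compm1 glue_compA.

Definition glue_inl : linear_functor C1 gluing :=
  @LinearFunctor k C1 gluing inl (fun _ _ f => f)
    (fun _ _ _ _ _ => erefl) (fun _ => erefl) (fun _ _ _ _ _ => erefl).

Definition glue_inr : linear_functor C2 gluing :=
  @LinearFunctor k C2 gluing inr (fun _ _ f => f)
    (fun _ _ _ _ _ => erefl) (fun _ => erefl) (fun _ _ _ _ _ => erefl).

Context (N : bimodule gluing gluing).

Definition r1 : bimodule C1 C1 := restriction glue_inl glue_inl N.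
Definition r2 : bimodule C2 C2 := restriction glue_inr glue_inr N.
Definition r12 : bimodule C1 C2 := restriction glue_inl glue_inr N.

End Gluing.

(* [chain n y x] is the type of n-tuples of composable morphisms
   (f_1, ..., f_n), in the order of the tensors f_1 \otimes ... \otimes f_n,
   together with their intermediate objects; f_1 has target y and f_n source x.
   The empty chain only exists from an object to itself. *)

Fixpoint chain (k : fieldType) (A : linear_category k) (n : nat) (y x : A) : Type :=
  match n with
  | 0 => y = x
  | m.+1 => {w : A & (hom A y w * chain m w x)%type}
  end.

Section Chains.
Context (k : fieldType) (A : linear_category k).

Definition ccons n (y w x : A) (f : hom A y w) (c : chain n w x) : chain n.+1 y x :=
  existT _ w (f, c).

(* (f_1, ..., f_{n+1}) is split as ((f_1, ..., f_n), f_{n+1}). *)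
Fixpoint csplit n (y x : A) : chain n.+1 y x -> {w : A & (chain n y w * hom A w x)%type} :=
  match n with
  | 0 => fun '(existT w (f, e)) =>
      existT _ y (erefl, match e in _ = z return hom A y z with erefl => f end)
  | m.+1 => fun '(existT w (f, c)) =>
      let: existT v (c', g) := csplit c in existT _ v (ccons f c', g)
  end.

(* For i <= n, (f_1, ..., f_{n+2}) is sent to
   (f_1, ..., f_{i+1} f_{i+2}, ..., f_{n+2}); larger values of i are not used. *)
Fixpoint cmerge (i n : nat) (y x : A) (c : chain n.+2 y x) : chain n.+1 y x :=
  let: existT w (f, existT v (g, c')) := c in
  match i, n return chain n v x -> chain n.+1 y x with
  | j.+1, m.+1 => fun c' => ccons f (cmerge j (ccons g c'))
  | _, _ => fun c' => ccons (comp f g) c'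
  end c'.

(* The index i : 'I_n stands for the composition f_{i+1} f_{i+2}. *)
Definition face n (y x : A) : 'I_n -> chain n.+1 y x -> chain n y x :=
  match n with
  | 0 => fun i _ => False_rect _ (notF (ltn_ord i))
  | m.+1 => fun i c => cmerge i c
  end.

(* Linearity in each f_i, the other ones (and the objects) being fixed: these
   are the linear maps on the tensor products over all intermediate objects. *)
Fixpoint multilinear (V : lmodType k) n (y x : A) : (chain n y x -> V) -> Prop :=
  match n with
  | 0 => fun _ => True
  | m.+1 => fun phi =>
      (forall (w : A) (c : chain m w x), linear (fun f : hom A y w => phi (ccons f c)))
      /\ (forall (w : A) (f : hom A y w), multilinear (fun c : chain m w x => phi (ccons f c)))
  end.

End Chains.

Section HochschildMitchell.
Context (k : fieldType) (A : linear_category k) (N : bimodule A A).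

(* An element of C^n(A, N): a family indexed by x_{n+1}, ..., x_1 (with
   y = x_{n+1} and x = x_1), multilinear in the morphisms. As an empty chain from
   y to x is a proof of y = x, C^0(A, N) is the product of the {}_x N_x. *)
Record cochain (n : nat) := Cochain {
  cochain_fun :> forall y x : A, chain n y x -> N y x;
  cochain_multilinear : forall y x, multilinear (@cochain_fun y x)
}.

Definition hm_diff_fun n (phi : forall y x : A, chain n y x -> N y x)
    (y x : A) (c : chain n.+1 y x) : N y x :=
  (let: existT w (f, c') := c in lact N f (phi w x c'))
  + \sum_(i < n) (-1) ^+ i.+1 *: phi y x (face i c)
  + (-1) ^+ n.+1 *: (let: existT w (c', f) := csplit c in ract N (phi y w c') f).

Fact multilinearD (V : lmodType k) n (y x : A) (phi psi : chain n y x -> V) (a : k) :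
  multilinear phi -> multilinear psi -> multilinear (fun c => a *: phi c + psi c).
Proof.
elim: n y phi psi => [//|n IHn] y phi psi /= [p1 p2] [q1 q2].
split=> [w c b f g|w f]; last exact: IHn.
by rewrite p1 q1 !scalerDr !scalerA [a * b]mulrC !addrA; congr (_ + _);
  rewrite -!addrA; congr (_ + _); rewrite addrC.
Qed.

Fact multilinear0 (V : lmodType k) n (y x : A) :
  multilinear (fun _ : chain n y x => 0 : V).
Proof.
by elim: n y => [//|n IHn] y /=; split=> [w c b f g|w f //]; rewrite scaler0 addr0.
Qed.

Fact multilinear_comp (V W : lmodType k) (h : V -> W) n (y x : A)
    (phi : chain n y x -> V) :
  linear h -> multilinear phi -> multilinear (fun c => h (phi c)).
Proof.
move=> hh; elim: n y phi => [//|n IHn] y phi /= [p1 p2].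
by split=> [w c b f g|w f]; [rewrite p1 hh|exact: IHn].
Qed.

Fact multilinear_ext (V : lmodType k) n (y x : A) (phi psi : chain n y x -> V) :
  (forall c, phi c = psi c) -> multilinear phi -> multilinear psi.
Proof. by move=> /funext ->. Qed.

Fact cochain_ext n (phi psi : cochain n) :
  (forall y x (c : chain n y x), phi y x c = psi y x c) -> phi = psi.
Proof.
case: phi psi => [phi hphi] [psi hpsi] /= e.
have {}e : phi = psi by do 2!apply: functional_extensionality_dep => ?; apply/funext.
by case: _ / e hpsi => hpsi; congr Cochain; exact: Prop_irrelevance.
Qed.

Fact cochain_add_multilinear n (phi psi : cochain n) y x :
  multilinear (fun c => phi y x c + psi y x c).
Proof.
apply: multilinear_ext (multilinearD 1 (cochain_multilinear phi y x)
  (cochain_multilinear psi y x)) => c.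
by rewrite scale1r.
Qed.

Fact cochain_scale_multilinear n (a : k) (phi : cochain n) y x :
  multilinear (fun c => a *: phi y x c).
Proof.
apply: multilinear_ext (multilinearD a (cochain_multilinear phi y x)
  (multilinear0 _ _ _ _)) => c.
by rewrite addr0.
Qed.

Definition cochain_zero n := @Cochain n (fun _ _ _ => 0) (fun y x => @multilinear0 (N y x) n y x).
Definition cochain_add n (phi psi : cochain n) :=
  Cochain (cochain_add_multilinear phi psi).
Definition cochain_scale n (a : k) (phi : cochain n) :=
  Cochain (cochain_scale_multilinear a phi).

HB.instance Definition _ n := gen_eqMixin (cochain n).
HB.instance Definition _ n := gen_choiceMixin (cochain n).

Fact cochain_addA n : associative (@cochain_add n).
Proof. by move=> f g h; apply: cochain_ext => y x c /=; rewrite addrA. Qed.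
Fact cochain_addC n : commutative (@cochain_add n).
Proof. by move=> f g; apply: cochain_ext => y x c /=; rewrite addrC. Qed.
Fact cochain_add0 n : left_id (cochain_zero n) (@cochain_add n).
Proof. by move=> f; apply: cochain_ext => y x c /=; rewrite add0r. Qed.
Fact cochain_addN n :
  left_inverse (cochain_zero n) (@cochain_scale n (-1)) (@cochain_add n).
Proof. by move=> f; apply: cochain_ext => y x c /=; rewrite scaleN1r addNr. Qed.

HB.instance Definition _ n := GRing.isZmodule.Build (cochain n)
  (@cochain_addA n) (@cochain_addC n) (@cochain_add0 n) (@cochain_addN n).

Fact cochain_scaleA n a b (f : cochain n) :
  cochain_scale a (cochain_scale b f) = cochain_scale (a * b) f.
Proof. by apply: cochain_ext => y x c /=; rewrite scalerA. Qed.
Fact cochain_scale1 n : left_id 1 (@cochain_scale n).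
Proof. by move=> f; apply: cochain_ext => y x c /=; rewrite scale1r. Qed.
Fact cochain_scaleDr n : right_distributive (@cochain_scale n) +%R.
Proof. by move=> a f g; apply: cochain_ext => y x c /=; rewrite scalerDr. Qed.
Fact cochain_scaleDl n (f : cochain n) :
  {morph (@cochain_scale n)^~ f : a b / a + b}.
Proof. by move=> a b; apply: cochain_ext => y x c /=; rewrite scalerDl. Qed.

HB.instance Definition _ n := GRing.Zmodule_isLmodule.Build k (cochain n)
  (@cochain_scaleA n) (@cochain_scale1 n) (@cochain_scaleDr n) (@cochain_scaleDl n).

(* The terms of the differential other than the first one; they only involve the
   right action, which allows an induction on the first morphism of the chain. *)
Definition hm_tail n (b y : A) (phi : forall x : A, chain n y x -> N b x) (x : A)
    (c : chain n.+1 y x) : N b x :=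
  \sum_(i < n) (-1) ^+ i.+1 *: phi x (face i c)
  + (-1) ^+ n.+1 *: (let: existT w (c', f) := csplit c in ract N (phi w c') f).

Fact hm_diff_tail n phi y x c : @hm_diff_fun n phi y x c =
  (let: existT w (f, c') := c in lact N f (phi w x c')) + hm_tail (phi y) c.
Proof. by rewrite /hm_diff_fun -addrA. Qed.

Fact hm_tail0 b y (phi : forall x : A, chain 0 y x -> N b x) x (f : hom A y x) :
  hm_tail phi (ccons f (erefl x : chain 0 x x)) = - ract N (phi y erefl) f.
Proof. by rewrite /hm_tail big_ord0 add0r expr1 scaleN1r. Qed.

Fact hm_tailS n b y (phi : forall x : A, chain n.+1 y x -> N b x) w v x
    (f : hom A y w) (g : hom A w v) (c : chain n v x) :
  hm_tail phi (ccons f (ccons g c)) =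
  - phi x (ccons (comp f g) c)
  - hm_tail (fun x' c' => phi x' (ccons f c')) (ccons g c).
Proof.
rewrite /hm_tail big_ord_recl expr1 scaleN1r opprD addrA -sumrN; congr (_ + _).
  congr (_ + _).
  apply: eq_bigr => i _; rewrite [in LHS]exprS mulN1r scaleNr; congr (- (_ *: _)).
  by case: n phi c i => [|n] phi c [].
rewrite [in LHS]exprS mulN1r scaleNr; congr (- (_ *: _)) => /=.
by case: (csplit _) => u [].
Qed.

Fact hm_tail_linear n b y (phi psi : forall x : A, chain n y x -> N b x) a x c :
  @hm_tail n b y (fun x c => a *: phi x c + psi x c) x c = a *: hm_tail phi c + hm_tail psi c.
Proof.
rewrite /hm_tail; case: (csplit c) => w [c' f].
rewrite (eq_bigr (fun i : 'I_n => a *: ((-1) ^+ i.+1 *: phi x (face i c))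
  + (-1) ^+ i.+1 *: psi x (face i c))); last first.
  by move=> i _; rewrite scalerDr !scalerA mulrC.
rewrite big_split /= -scaler_sumr ract_linearl !scalerDr !scalerA.
by rewrite [(-1) ^+ n.+1 * a]mulrC !addrA; congr (_ + _); rewrite addrAC.
Qed.

Fact hm_tail_ext n b y (phi psi : forall x : A, chain n y x -> N b x) x (c : chain n.+1 y x) :
  (forall x' (c' : chain n y x'), phi x' c' = psi x' c') -> hm_tail phi c = hm_tail psi c.
Proof.
move=> e; rewrite /hm_tail; case: (csplit c) => w [c' f].
by rewrite e; congr (_ + _); apply: eq_bigr => i _; rewrite e.
Qed.

Fact multilinear_merge n (b y w x : A) (phi : chain n.+1 y x -> N b x) (f : hom A y w) :
  multilinear phi ->
  multilinear (fun c : chain n.+1 w x =>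
    let: existT v (g, c') := c in phi (ccons (comp f g) c')).
Proof.
case=> p1 p2 /=; split=> [v c a g h|v g]; last exact: p2.
by rewrite comp_linearr p1.
Qed.

Fact hm_tail_multilinear n b y (phi : forall x : A, chain n y x -> N b x) :
  (forall x, multilinear (phi x)) -> forall x, multilinear (@hm_tail n b y phi x).
Proof.
elim: n y phi => [|n IHn] y phi hphi x.
  split=> [w e a f g|w f //]; case: _ / e f g => f g.
  by rewrite !hm_tail0 ract_linearr opprD scalerN.
split=> [w [v [h c]] a f g|w f].
  rewrite -/(ccons h c) !hm_tailS; case: (hphi x) => p1 _.
  rewrite comp_linearl p1 (hm_tail_ext (psi := fun x' c' =>
    a *: phi x' (ccons f c') + phi x' (ccons g c'))); last first.
    by move=> x' c'; case: (hphi x') => p1' _; rewrite p1'.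
  rewrite hm_tail_linear; move: (hm_tail _ _) (hm_tail _ _) (phi _ _) (phi _ _) => X Y P Q.
  by rewrite !opprD scalerBr scalerN addrACA.
have h1 := multilinear_merge f (hphi x).
have h2 : multilinear (@hm_tail n b w (fun x' c' => phi x' (ccons f c')) x).
  by apply: IHn => x'; case: (hphi x') => _; apply.
apply: multilinear_ext (multilinearD (-1) h1 (multilinearD (-1) h2 (multilinear0 _ _ _ _))).
by case=> v [g c]; rewrite -/(ccons g c) hm_tailS addr0 !scaleN1r.
Qed.

Fact hm_diff_multilinear n (phi : cochain n) y x :
  multilinear (@hm_diff_fun n phi y x).
Proof.
have h1 : multilinear (fun c : chain n.+1 y x =>
    let: existT w (f, c') := c in lact N f (phi w x c')).
  split=> [w c a f g|w f]; first by rewrite /= lact_linearl.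
  exact: multilinear_comp (lact_linearr f) (cochain_multilinear phi w x).
have h2 := hm_tail_multilinear (fun x' => cochain_multilinear phi y x') x.
apply: multilinear_ext (multilinearD 1 h1 h2) => c.
by rewrite hm_diff_tail scale1r.
Qed.

Definition hm_diff n (phi : cochain n) : cochain n.+1 :=
  Cochain (hm_diff_multilinear phi).

Fact hm_diff_linear n : linear (@hm_diff n).
Proof.
move=> a phi psi; apply: cochain_ext => y x c.
rewrite /= !hm_diff_tail hm_tail_linear.
move: (hm_tail _ _) (hm_tail _ _) => X Y; case: c => w [f c].
by rewrite lact_linearr scalerDr addrACA.
Qed.
HB.instance Definition _ n :=
  GRing.isLinear.Build k (cochain n) (cochain n.+1) *:%R (@hm_diff n) (@hm_diff_linear n).

Fact hm_tailND n b y (phi psi : forall x : A, chain n y x -> N b x) x c :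
  @hm_tail n b y (fun x c => - phi x c - psi x c) x c = - hm_tail phi c - hm_tail psi c.
Proof.
have e0 : @hm_tail n b y (fun _ _ => 0) x c = 0.
  have := @hm_tail_linear n b y (fun _ _ => 0) (fun _ _ => 0) (-1) x c.
  rewrite scaleN1r addNr => <-.
  by apply: hm_tail_ext => x' c'; rewrite scaler0 addr0.
rewrite -[- hm_tail psi c]addr0 -e0 -!scaleN1r -!hm_tail_linear.
by apply: hm_tail_ext => x' c'; rewrite addr0 !scaleN1r.
Qed.

Fact hm_tail_tail n b y (phi : forall x : A, chain n y x -> N b x) x (c : chain n.+2 y x) :
  hm_tail (fun x' c' => @hm_tail n b y phi x' c') c = 0.
Proof.
elim: n y phi c => [|n IHn] y phi [w [f [v [g c]]]].
  case: _ / c; rewrite -/(ccons g (erefl : chain 0 v v)) -/(ccons f (ccons g _)).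
  rewrite hm_tailS !hm_tail0 ractA opprK.
  have := ract_linearl g (-1) (ract N (phi y erefl) f) 0.
  by rewrite !scaleN1r ract0m !addr0 => ->; rewrite opprK subrr.
case: c => u [h c]; rewrite -/(ccons h c) -/(ccons g (ccons h c)).
rewrite -/(ccons f (ccons g (ccons h c))) 2!hm_tailS.
pose psi x' (c' : chain n.+1 w x') :=
  let: existT v (g, c'') := c' in phi x' (ccons (comp f g) c'').
rewrite (@hm_tail_ext _ _ _ (fun x' c' => hm_tail phi (ccons f c'))
  (fun x' c' => - psi x' c' - hm_tail (fun x'' c'' => phi x'' (ccons f c'')) c')); last first.
  by move=> x' [v' [g' c']]; rewrite -/(ccons g' c') hm_tailS.
rewrite hm_tailND IHn subr0 hm_tailS /= compA.
by rewrite subrr.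
Qed.

Fact lactD a' a b (f : hom A a' a) (m m' : N a b) :
  lact N f (m + m') = lact N f m + lact N f m'.
Proof. by have := lact_linearr f 1 m m'; rewrite !scale1r. Qed.

Fact lactZ a' a b (f : hom A a' a) (c : k) (m : N a b) :
  lact N f (c *: m) = c *: lact N f m.
Proof. by have := lact_linearr f c m 0; rewrite lactm0 !addr0. Qed.

Fact hm_tail_lact n b' b y (h : hom A b' b) (phi : forall x : A, chain n y x -> N b x)
    x (c : chain n.+1 y x) :
  hm_tail (fun x' c' => lact N h (phi x' c')) c = lact N h (hm_tail phi c).
Proof.
rewrite /hm_tail; case: (csplit c) => w [c' f].
rewrite lactD lactZ lractA (big_morph _ (lactD h) (lactm0 N _ h)).
by congr (_ + _); apply: eq_bigr => i _; rewrite lactZ.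
Qed.

Fact hm_diffK n (phi : cochain n) : hm_diff (hm_diff phi) = 0.
Proof.
apply: cochain_ext => y x [w [f [v [g c]]]].
rewrite [LHS]hm_diff_tail /= hm_diff_tail lactD -lactA.
pose L x' (c' : chain n.+1 y x') :=
  let: existT w (f, c'') := c' in lact N f (phi w x' c'').
rewrite -/(ccons g c) -/(ccons f (ccons g c)).
rewrite (@hm_tail_ext _ _ _ _ (fun x' c' => 1 *: L x' c' + hm_tail (phi y) c')); last first.
  by move=> x' c'; rewrite hm_diff_tail scale1r.
rewrite hm_tail_linear hm_tail_tail addr0 scale1r hm_tailS /=.
rewrite (hm_tail_lact f (phi w)) -[X in _ + X]opprD subrr.
by [].
Qed.

Definition hm_complex : cochain_complex k :=
  @CochainComplex k (fun n => cochain n) (fun n => @hm_diff n) hm_diffK.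

Definition HM (n : nat) : lmodType k := cohomology hm_complex n.

End HochschildMitchell.

Section BimoduleHom.
Context (k : fieldType) (A B : linear_category k).

Record bimod_hom (M N : bimodule A B) := BimodHom {
  bhom_fun :> forall a b, M a b -> N a b;
  bhom_linear : forall a b, linear (@bhom_fun a b);
  bhom_lact : forall a' a b (f : hom A a' a) (m : M a b),
    bhom_fun (lact M f m) = lact N f (bhom_fun m);
  bhom_ract : forall a b b' (m : M a b) (g : hom B b b'),
    bhom_fun (ract M m g) = ract N (bhom_fun m) g
}.

Fact bimod_hom_ext (M N : bimodule A B) (u v : bimod_hom M N) :
  (forall a b (m : M a b), u a b m = v a b m) -> u = v.
Proof.
case: u v => [u u1 u2 u3] [v v1 v2 v3] /= e.
have {}e : u = v by do 2!apply: functional_extensionality_dep => ?; apply/funext.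
by case: _ / e v1 v2 v3 => v1 v2 v3; congr BimodHom; exact: Prop_irrelevance.
Qed.

Section Operations.
Context (M N : bimodule A B).

Definition bimod_hom_zero : bimod_hom M N.
Proof.
exists (fun _ _ _ => 0).
- by move=> a b c m m'; rewrite scaler0 addr0.
- by move=> *; rewrite lactm0.
- by move=> *; rewrite ract0m.
Defined.

Definition bimod_hom_comb (c : k) (u v : bimod_hom M N) : bimod_hom M N.
Proof.
exists (fun a b m => c *: u a b m + v a b m).
- move=> a b d m m'; rewrite !bhom_linear !scalerDr !scalerA [c * d]mulrC.
  exact: addrACA.
- by move=> *; rewrite !bhom_lact lact_linearr.
- by move=> *; rewrite !bhom_ract ract_linearl.
Defined.

Definition bimod_hom_add (u v : bimod_hom M N) := bimod_hom_comb 1 u v.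
Definition bimod_hom_scale (c : k) (u : bimod_hom M N) :=
  bimod_hom_comb c u bimod_hom_zero.

HB.instance Definition _ := gen_eqMixin (bimod_hom M N).
HB.instance Definition _ := gen_choiceMixin (bimod_hom M N).

Fact bimod_hom_addA : associative bimod_hom_add.
Proof.
by move=> f g h; apply: bimod_hom_ext => a b m /=; rewrite !scale1r addrA.
Qed.
Fact bimod_hom_addC : commutative bimod_hom_add.
Proof. by move=> f g; apply: bimod_hom_ext => a b m /=; rewrite !scale1r addrC. Qed.
Fact bimod_hom_add0 : left_id bimod_hom_zero bimod_hom_add.
Proof. by move=> f; apply: bimod_hom_ext => a b m /=; rewrite scale1r add0r. Qed.
Fact bimod_hom_addN :
  left_inverse bimod_hom_zero (bimod_hom_scale (-1)) bimod_hom_add.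
Proof.
by move=> f; apply: bimod_hom_ext => a b m /=; rewrite addr0 scale1r scaleN1r addNr.
Qed.

HB.instance Definition _ := GRing.isZmodule.Build (bimod_hom M N)
  bimod_hom_addA bimod_hom_addC bimod_hom_add0 bimod_hom_addN.

Fact bimod_hom_scaleA c d (f : bimod_hom M N) :
  bimod_hom_scale c (bimod_hom_scale d f) = bimod_hom_scale (c * d) f.
Proof. by apply: bimod_hom_ext => a b m /=; rewrite !addr0 scalerA. Qed.
Fact bimod_hom_scale1 : left_id 1 bimod_hom_scale.
Proof. by move=> f; apply: bimod_hom_ext => a b m /=; rewrite addr0 scale1r. Qed.
Fact bimod_hom_scaleDr : right_distributive bimod_hom_scale +%R.
Proof.
by move=> c f g; apply: bimod_hom_ext => a b m /=; rewrite !addr0 !scale1r scalerDr.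
Qed.
Fact bimod_hom_scaleDl (f : bimod_hom M N) :
  {morph bimod_hom_scale^~ f : c d / c + d}.
Proof.
by move=> c d; apply: bimod_hom_ext => a b m /=; rewrite !addr0 scale1r scalerDl.
Qed.

HB.instance Definition _ := GRing.Zmodule_isLmodule.Build k (bimod_hom M N)
  bimod_hom_scaleA bimod_hom_scale1 bimod_hom_scaleDr bimod_hom_scaleDl.

End Operations.

Definition bimod_hom_comp (M N P : bimodule A B) (v : bimod_hom N P)
  (u : bimod_hom M N) : bimod_hom M P.
Proof.
exists (fun a b m => v a b (u a b m)).
- by move=> a b c m m'; rewrite !bhom_linear.
- by move=> *; rewrite !bhom_lact.
- by move=> *; rewrite !bhom_ract.
Defined.

Definition bimod_surjective (M N : bimodule A B) (p : bimod_hom M N) : Prop :=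
  forall a b (n : N a b), exists m : M a b, p a b m = n.

Definition projective (P : bimodule A B) : Prop :=
  forall (M N : bimodule A B) (p : bimod_hom M N) (u : bimod_hom P N),
    bimod_surjective p -> exists v : bimod_hom P M, bimod_hom_comp p v = u.

Record projective_resolution (M : bimodule A B) := ProjectiveResolution {
  pres_term :> nat -> bimodule A B;
  pres_diff : forall n, bimod_hom (pres_term n.+1) (pres_term n);
  pres_aug : bimod_hom (pres_term 0) M;
  pres_projective : forall n, projective (pres_term n);
  pres_aug_surjective : bimod_surjective pres_aug;
  pres_exact0 : forall a b (p : pres_term 0 a b),
    pres_aug a b p = 0 <-> exists q, pres_diff 0 a b q = p;
  pres_exact : forall n a b (p : pres_term n.+1 a b),
    pres_diff n a b p = 0 <-> exists q, pres_diff n.+1 a b q = p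
}.

Section Ext.
Context (M : bimodule A B) (P : projective_resolution M) (N : bimodule A B).

Definition ext_diff n (u : bimod_hom (P n) N) : bimod_hom (P n.+1) N :=
  bimod_hom_comp u (pres_diff P n).

Fact ext_diff_linear n : linear (@ext_diff n).
Proof. by move=> c u v; apply: bimod_hom_ext => a b m /=; rewrite !addr0 !scale1r. Qed.
HB.instance Definition _ n := GRing.isLinear.Build k (bimod_hom (P n) N)
  (bimod_hom (P n.+1) N) *:%R (@ext_diff n) (@ext_diff_linear n).

Fact ext_diffK n (u : bimod_hom (P n) N) : ext_diff (ext_diff u) = 0.
Proof.
apply: bimod_hom_ext => a b m /=.
have -> : pres_diff P n a b (pres_diff P n.+1 a b m) = 0.
  by apply/pres_exact; exists m.
exact: linear_fun0 (bhom_linear u (a := a) (b := b)).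
Qed.

Definition ext_complex : cochain_complex k :=
  @CochainComplex k (fun n => bimod_hom (P n) N) (fun n => @ext_diff n) ext_diffK.

(* Ext^n_{A \boxtimes B^op}(M, N), computed from the projective resolution P of M;
   it does not depend on P up to isomorphism. *)
Definition Ext (n : nat) : lmodType k := cohomology ext_complex n.

End Ext.

End BimoduleHom.

Definition exact_at (k : fieldType) (U V W : lmodType k)
    (f : {linear U -> V}) (g : {linear V -> W}) : Prop :=
  forall v : V, g v = 0 <-> exists u : U, f u = v.

(* Main.v *)
From HB Require Import structures.
From mathcomp Require Import all_boot all_order all_algebra.
From mathcomp Require Import generic_quotient ring_quotient.
From mathcomp Require Import boolp classical_sets.
Require Import Defs.
Import GRing.Theory.

Set Implicit Arguments.
Unset Strict Implicit.
Unset Printing Implicit Defensive.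

Local Open Scope ring_scope.

(** Every cochain on the gluing restricts to a pair of cochains on [C1] and [C2].
    The restriction is onto, since a pair can be extended by zero, and because no
    nonzero morphism goes from an object of [C1] to an object of [C2] its kernel
    consists of the cochains with values in the sub-bimodule of [N] that lives on
    the pairs of an object of [C1] and an object of [C2]. This sub-bimodule is the
    extension by zero [ext0] of [r12 N], so [gluing_short_exact] is a short exact
    sequence of complexes and gives a long exact sequence. It remains to identify
    the cohomology of the kernel: [Ext_iso_HM] says that, for every bimodule [X],
    [Ext^n(M, X)] is isomorphic to [H^(n+1)(gluing M, ext0 X)].

    A conceptual reason is that the complex of [ext0 X], shifted by one, consists
    of the homomorphisms to [X] from the two-sided bar resolution of [M]. The proof
    replaces this resolution by dimension shifting in [X], which never needs tensor
    products. Each [X] embeds in the coinduced bimodule of functions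
    [(h, l) |-> h m l], by a map that evaluation at the identities splits linearly;
    let [X''] be the cokernel. Both theories turn the short exact sequence from [X]
    to [X''] into a short exact sequence of complexes: for [Ext] because the terms
    of the resolution are projective, for Hochschild-Mitchell cochains because the
    sequence splits linearly. In lowest degree both theories are [Hom(M, X)].
    Coinduced bimodules are acyclic for both: for [Ext] because a homomorphism into
    one is just a linear map, and linear maps extend from subspaces
    ([ext_coinduced_acyclic], where it matters that [k] is a field);
    for cochains by two explicit homotopies, inserting a morphism at the left and at
    the right end of a chain ([ext0_coinduced_acyclic]). The connecting maps then
    give the isomorphism in degree [n+1] for [X] from the one in degree [n] for
    [X'']. *)

(** * Linear relations and extension of linear maps *)

Definition linear_relation (k : fieldType) (V W : lmodType k) (R : V -> W -> Prop) :=
  R 0 0 /\ forall a v w v' w', R v w -> R v' w' -> R (a *: v + v') (a *: w + w').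

(** For a linear relation, having a single value at [0] is the same as having at
    most one value everywhere. *)
Definition single_valued (k : fieldType) (V W : lmodType k) (R : V -> W -> Prop) :=
  forall w, R 0 w -> w = 0.

Section LinearRelations.
Context (k : fieldType).

(** Maps on cohomology are described by the representatives they relate, so the
    linear maps of this file are obtained from relations rather than formulas. *)
Lemma linear_relation_fun (V W : lmodType k) (R : V -> W -> Prop) :
  linear_relation R -> single_valued R -> (forall v, exists w, R v w) ->
  exists f : {linear V -> W}, forall v w, f v = w <-> R v w.
Proof.
move=> [R0 RL] R1 /choice [f fR].
have uniqR v w : R v w -> f v = w.
  move=> Rvw; apply/eqP; rewrite -subr_eq0; apply/eqP/R1.
  by have := RL (-1) _ _ _ _ Rvw (fR v); rewrite !scaleN1r addNr addrC.
have f_linear : linear f by move=> a u v; apply: uniqR; exact: RL.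
pose fL := GRing.isLinear.Build k V W *:%R f f_linear.
pose F : {linear V -> W} := HB.pack f fL.
by exists F => v w; split=> [<-|]; [exact: fR|exact: uniqR].
Qed.

Definition isomorphic (V W : lmodType k) : Prop :=
  exists (f : {linear V -> W}) (g : {linear W -> V}), cancel f g /\ cancel g f.

Lemma linear_relation_inverse (V W : lmodType k) (R : V -> W -> Prop) :
  linear_relation R -> single_valued R -> single_valued (fun w v => R v w) ->
  (forall v, exists w, R v w) -> (forall w, exists v, R v w) ->
  exists (f : {linear V -> W}) (g : {linear W -> V}),
    [/\ cancel f g, cancel g f & forall v, R v (f v)].
Proof.
move=> RL R1 R1' Rtot Rtot'.
have [f fR] := linear_relation_fun RL R1 Rtot.
have RL' : linear_relation (fun w v => R v w).
  by case: RL => R0 RL; split=> // a w v w' v'; exact: RL.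
have [g gR] := linear_relation_fun RL' R1' Rtot'.
by exists f, g; split=> [v|w|v]; [apply/gR/fR|apply/fR/gR|apply/fR].
Qed.

Lemma linear_relation_iso (V W : lmodType k) (R : V -> W -> Prop) :
  linear_relation R -> single_valued R -> single_valued (fun w v => R v w) ->
  (forall v, exists w, R v w) -> (forall w, exists v, R v w) -> isomorphic V W.
Proof.
move=> RL R1 R1' Rtot Rtot'.
have [f [g [fK gK _]]] := linear_relation_inverse RL R1 R1' Rtot Rtot'.
by exists f, g.
Qed.

Lemma iso_sym V W : isomorphic V W -> isomorphic W V.
Proof. by move=> [f [g [fK gK]]]; exists g, f. Qed.

Lemma iso_trans U V W : isomorphic U V -> isomorphic V W -> isomorphic U W.
Proof.
move=> [f [f' [fK f'K]]] [g [g' [gK g'K]]].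
by exists (g \o f), (f' \o g'); split=> x /=; rewrite ?gK ?fK ?f'K ?g'K.
Qed.

Lemma iso_same_kernel (U V W : lmodType k) (s : {linear U -> V}) (t : {linear U -> W}) :
  (forall v, exists u, s u = v) -> (forall w, exists u, t u = w) ->
  (forall u, s u = 0 <-> t u = 0) -> isomorphic V W.
Proof.
move=> s_surj t_surj st.
apply: (@linear_relation_iso _ _ (fun v w => exists2 u, s u = v & t u = w)).
- split; first by exists 0; rewrite linear0.
  move=> a v w v' w' [u <- <-] [u' <- <-].
  by exists (a *: u + u'); rewrite linearP.
- by move=> w [u /st su0 <-].
- by move=> v [u <- /st].
- by move=> v; have [u su] := s_surj v; exists (t u), u.
- by move=> w; have [u tu] := t_surj w; exists (s u), u.
Qed.

Local Open Scope classical_set_scope.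

(** By Zorn's lemma there is a maximal single-valued linear relation containing
    [G]; if it had no value at [v], then letting [v] have the value [0] would give a
    larger one, because [k] is a field. *)
Lemma linear_relation_total (V W : lmodType k) (G : V -> W -> Prop) :
  linear_relation G -> single_valued G ->
  exists R : V -> W -> Prop, [/\ linear_relation R, single_valued R,
    forall v w, G v w -> R v w & forall v, exists w, R v w].
Proof.
move=> GL G1.
(* Adding [G] to each set of pairs makes the empty chain admissible for Zorn. *)
pose rel (A : set (V * W)) v w := A (v, w) \/ G v w.
pose good (A : set (V * W)) := linear_relation (rel A) /\ single_valued (rel A).
have rel0 : rel set0 = G.
  by apply/funext => u; apply/funext => x; apply/propext; split=> [[]|] //; right.
have [F Fgood Ftot|A [[AL A1] Amax]] := @Zorn_bigcup (V * W)%type good.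
  have dir v w v' w' : rel (\bigcup_(X in F) X) v w ->
      rel (\bigcup_(X in F) X) v' w' ->
      exists A, [/\ rel A v w, rel A v' w', good A &
        forall u x, rel A u x -> rel (\bigcup_(X in F) X) u x].
    have sub X : F X -> forall u x, rel X u x -> rel (\bigcup_(X in F) X) u x.
      by move=> FX u x [Xux|]; [left; exists X|right].
    case=> [[X FX Xvw]|Gvw] [[Y FY Yvw]|Gvw'].
    - case: (Ftot _ _ FX FY) => XY.
        exists Y; split; [by left; exact: XY|by left|exact: Fgood|exact: sub].
      exists X; split; [by left|by left; exact: XY|exact: Fgood|exact: sub].
    - by exists X; split; [left|right|exact: Fgood|exact: sub].
    - by exists Y; split; [right|left|exact: Fgood|exact: sub].
    - exists set0; split; [by right|by right| |by move=> u x [[]|]; right].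
      by rewrite /good rel0.
  split; first split.
  - by right; case: GL.
  - move=> a v w v' w' Rvw Rvw'.
    have [A [Avw Avw' [[_ AL] _] sub]] := dir _ _ _ _ Rvw Rvw'.
    exact/sub/AL.
  - move=> w Rw; have [A [Aw _ [_ A1] _]] := dir _ _ _ _ Rw Rw.
    exact: A1.
exists (rel A); split=> //; first by right.
move=> v; apply: contrapT => v_notin.
have {}v_notin w : ~ rel A v w by move=> Avw; apply: v_notin; exists w.
(* The sum of the maximal relation and of the line spanned by [(v, 0)]. *)
pose B : set (V * W) := [set p | exists2 c : k, True & rel A (p.1 - c *: v) p.2].
have Bsub u w : rel A u w -> rel B u w.
  by move=> Auw; left; exists 0 => //=; rewrite scale0r subr0.
have relB : rel B = fun u w => B (u, w).
  apply/funext => u; apply/funext => w; apply/propext; split=> [[//|Guw]|]; last by left.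
  by exists 0 => //=; rewrite scale0r subr0; right.
case: (AL) => A0 ALin.
apply: (Amax B); last first.
  rewrite /good relB; split; first split.
  - by exists 0 => //=; rewrite scale0r subr0.
  - move=> a u w u' w' [c _ /= Au] [c' _ /= Au']; exists (a * c + c') => //=.
    have -> : a *: u + u' - (a * c + c') *: v =
        a *: (u - c *: v) + (u' - c' *: v).
      by rewrite scalerBr scalerDl scalerA opprD addrACA.
    exact: ALin.
  - move=> w [c _ /=]; rewrite sub0r => Acw; have [c0|c_neq0] := eqVneq c 0.
      by apply: A1; move: Acw; rewrite c0 scale0r oppr0.
    case: (v_notin (- c^-1 *: w)); have := ALin (- c^-1) _ _ _ _ Acw A0.
    by rewrite !addr0 scalerN scaleNr opprK scalerA mulVf // scale1r.
split.
  by move=> [u w] Auw; exists 0 => //=; rewrite scale0r subr0; left.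
move=> BA; apply: (v_notin 0); left; apply: BA.
by exists 1 => //=; rewrite scale1r subrr.
Qed.

(** On the image of [p] the map [f] is forced, and it extends to the whole of [V]:
    every vector space over a field is injective. *)
Lemma linear_factor (U V W : lmodType k) (p : U -> V) (q : U -> W) :
  linear p -> linear q -> (forall u, p u = 0 -> q u = 0) ->
  exists f : {linear V -> W}, forall u, f (p u) = q u.
Proof.
move=> p_lin q_lin pq; have p0 := linear_fun0 p_lin; have q0 := linear_fun0 q_lin.
have [||R [RL R1 GR Rtot]] :=
  @linear_relation_total V W (fun v w => exists2 u, p u = v & q u = w).
- split; first by exists 0.
  move=> a v w v' w' [u <- <-] [u' <- <-].
  by exists (a *: u + u'); [exact: p_lin|exact: q_lin].
- by move=> w [u /pq qu0 <-].
have [f fR] := linear_relation_fun RL R1 Rtot.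
by exists f => u; apply/fR/GR; exists u.
Qed.

End LinearRelations.

(** * Cohomology classes and the long exact sequence *)

Section Representatives.
Local Open Scope quotient_scope.
Context (k : fieldType) (K : cochain_complex k) (n : nat).
Implicit Types (x y : cohomology K n) (a b : K n).

Definition represents x a : Prop :=
  exists2 z : cocycle K n, z = a :> K n & \pi_(cohomology K n) z = x.

Lemma represents_ex x : exists a, represents x a.
Proof. by exists (repr x : cocycle K n), (repr x); rewrite ?reprK. Qed.

Lemma represents_cocycle x a : represents x a -> cdiff K n a = 0.
Proof. by case=> z <- _; apply/eqP; exact: cocycle_valP z. Qed.

Lemma cocycle_represents a : cdiff K n a = 0 -> exists x, represents x a.
Proof.
move=> /eqP da; have za : a \in @cocycle_pred k K n by [].
by exists (\pi_(cohomology K n) (Cocycle za)), (Cocycle za).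
Qed.

Lemma represents0 : represents 0 0.
Proof. by exists 0 => //; rewrite raddf0. Qed.

Lemma represents_comb c x y a b :
  represents x a -> represents y b -> represents (c *: x + y) (c *: a + b).
Proof.
move=> [z <- <-] [w <- <-]; exists (c *: z + w) => //.
by rewrite raddfD /=; congr (_ + _); exact: pi_cohomology_scale.
Qed.

Lemma represents_eq0 x a : represents x a -> (x = 0 <-> is_coboundary a).
Proof.
move=> [z <- <-].
have -> : is_coboundary (z : K n) <-> z \in @coboundary k K n.
  by split=> [h|]; [apply/asboolP|move/asboolP].
rewrite -[z in z \in _]subr0 Quotient.idealrBE -(rwP eqP).
by have -> : \pi_(cohomology K n) (0 : cocycle K n) = 0 by rewrite raddf0.
Qed.

Lemma coboundary0 : is_coboundary (0 : K n).
Proof. exact/(represents_eq0 represents0). Qed.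

Lemma coboundaryN a : is_coboundary a -> is_coboundary (- a).
Proof.
by move=> /(is_coboundary_closed (-1)) /(_ coboundary0); rewrite addr0 scaleN1r.
Qed.

Lemma represents_coboundary_eq x y a b :
  represents x a -> represents y b -> is_coboundary (a - b) -> x = y.
Proof.
move=> xa yb ab; apply/eqP; rewrite -subr_eq0; apply/eqP.
have := represents_comb (-1) yb xa; rewrite !scaleN1r addrC [- b + a]addrC.
by move=> /represents_eq0 ->.
Qed.

End Representatives.

Section ChainMaps.
Context (k : fieldType).

Record chain_map (K L : cochain_complex k) := ChainMap {
  cmap :> forall n, {linear K n -> L n};
  cmap_diff : forall n (x : K n), cmap n.+1 (cdiff K n x) = cdiff L n (cmap n x) }.

Lemma cmap_coboundary (K L : cochain_complex k) (f : chain_map K L) n (a : K n) :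
  is_coboundary a -> is_coboundary (f n a).
Proof.
case: n a => [|n] a /=; first by move=> ->; rewrite linear0.
by case=> b ->; exists (f n b); rewrite cmap_diff.
Qed.

Lemma cmap_cocycle (K L : cochain_complex k) (f : chain_map K L) n (a : K n) :
  cdiff K n a = 0 -> cdiff L n (f n a) = 0.
Proof. by rewrite -cmap_diff => ->; rewrite linear0. Qed.

Lemma cohomology_map_exists (K L : cochain_complex k) (f : chain_map K L) n :
  exists h : {linear cohomology K n -> cohomology L n},
    forall x a, represents x a -> represents (h x) (f n a).
Proof.
have [|||h hP] := @linear_relation_fun k (cohomology K n) (cohomology L n)
    (fun x y => exists2 a, represents x a & represents y (f n a)).
- split; first by exists 0; rewrite ?linear0; exact: represents0.
  move=> c x y x' y' [a xa ya] [a' xa' ya'].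
  by exists (c *: a + a'); rewrite ?linearP; exact: represents_comb.
- move=> y [a a0 ya]; apply/(represents_eq0 ya)/cmap_coboundary.
  by apply/(represents_eq0 a0).
- move=> x; have [a xa] := represents_ex x.
  have [y ya] := cocycle_represents (cmap_cocycle f (represents_cocycle xa)).
  by exists y, a.
exists h => x a xa.
have [y ya] := cocycle_represents (cmap_cocycle f (represents_cocycle xa)).
by have -> : h x = y by apply/hP; exists a.
Qed.

Definition cohomology_map K L (f : chain_map K L) n :=
  sval (cid (cohomology_map_exists f n)).

Lemma cohomology_mapP K L (f : chain_map K L) n x a :
  represents x a -> represents (cohomology_map f n x) (f n a).
Proof. exact: (svalP (cid (cohomology_map_exists f n))). Qed.

End ChainMaps.

Section LongExactSequence.
Context (k : fieldType) (K L Q : cochain_complex k).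
Context (i : chain_map K L) (p : chain_map L Q).

Record short_exact : Prop := ShortExact {
  short_exact_inj : forall n, injective (i n);
  short_exact_mid : forall n, exact_at (i n) (p n);
  short_exact_surj : forall n y, exists x, p n x = y }.

Hypothesis ip : short_exact.

Lemma short_exact_comp n x : p n (i n x) = 0.
Proof. by apply/(short_exact_mid ip); exists x. Qed.

(** The snake: [x] is sent to [y] when [x] is the class of [p b] and [y] that of an
    [a] with [i a = d b]. The values at [0] vanish since such a [b] can be corrected
    by a coboundary so as to come from [K]. *)
Lemma connecting_exists n :
  exists d : {linear cohomology Q n -> cohomology K n.+1}, forall x y,
    d x = y <-> exists b a,
      [/\ represents x (p n b), cdiff L n b = i n.+1 a & represents y a].
Proof.
apply: linear_relation_fun.
- split.
    by exists 0, 0; rewrite !linear0; split=> //; exact: represents0.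
  move=> c x y x' y' [b [a [xb ba ya]]] [b' [a' [xb' ba' ya']]].
  exists (c *: b + b'), (c *: a + a'); rewrite !linearP ba ba'.
  by split=> //; exact: represents_comb.
- move=> y [b [a [b0 ba ya]]]; apply/(represents_eq0 ya) => /=.
  have [b' b'K pb'] : exists2 b', cdiff L n b' = 0 & p n b' = p n b.
    move/(represents_eq0 b0): (erefl (0 : cohomology Q n)).
    case: n b {a ba ya b0 y} => [|n] b /=; first by exists 0; rewrite ?linear0.
    case=> q pb; have [b' pb'] := short_exact_surj ip q.
    by exists (cdiff L n b'); rewrite ?cdiffK // cmap_diff pb' pb.
  have /(short_exact_mid ip)[a' ia'] : p n (b - b') = 0 by rewrite linearB pb' subrr.
  exists a'; apply: (short_exact_inj ip); rewrite cmap_diff ia' linearB b'K subr0.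
  by rewrite ba.
- move=> x; have [q xq] := represents_ex x; have [b pb] := short_exact_surj ip q.
  have /(short_exact_mid ip)[a ia] : p n.+1 (cdiff L n b) = 0.
    by rewrite cmap_diff pb (represents_cocycle xq).
  have /cocycle_represents[y ya] : cdiff K n.+1 a = 0.
    by apply: (short_exact_inj ip); rewrite cmap_diff ia cdiffK linear0.
  by exists y, b, a; rewrite pb.
Qed.

Definition connecting n := sval (cid (connecting_exists n)).

Lemma connectingP n x y : connecting n x = y <->
  exists b a, [/\ represents x (p n b), cdiff L n b = i n.+1 a & represents y a].
Proof. exact: (svalP (cid (connecting_exists n))). Qed.

Lemma cohomology_map_exact n : exact_at (cohomology_map i n) (cohomology_map p n).
Proof.
move=> y; split=> [|[x <-]]; last first.
  have [a xa] := represents_ex x.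
  apply/(represents_eq0 (cohomology_mapP p (cohomology_mapP i xa))).
  by rewrite short_exact_comp; apply/(represents_eq0 (represents0 _ _)).
have [b yb] := represents_ex y => /(represents_eq0 (cohomology_mapP p yb)) pb.
have [b' b'b pb'] : exists2 b', is_coboundary b' & p n b' = p n b.
  case: n y b yb pb => [|n] y b yb /= pb; first by exists 0; rewrite ?linear0.
  have [q pbq] := pb; have [b' pb'] := short_exact_surj ip q.
  by exists (cdiff L n b'); [exists b'|rewrite cmap_diff pb' pbq].
have b'K : cdiff L n b' = 0.
  case: n b' b'b {y b yb pb pb'} => [|n] b' /=; first by move=> ->; rewrite linear0.
  by case=> c ->; rewrite cdiffK.
have /(short_exact_mid ip)[a ia] : p n (b - b') = 0 by rewrite linearB pb' subrr.
have /cocycle_represents[x xa] : cdiff K n a = 0.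
  apply: (short_exact_inj ip).
  by rewrite cmap_diff ia linearB b'K (represents_cocycle yb) subr0 linear0.
exists x; apply: (represents_coboundary_eq (cohomology_mapP i xa) yb).
rewrite ia addrAC subrr add0r; exact: coboundaryN.
Qed.

Lemma connecting_exact n : exact_at (cohomology_map p n) (connecting n).
Proof.
move=> x; split=> [|[y <-]].
  move/connectingP=> [b [a [xb ba a0]]].
  have [a' aa'] : is_coboundary a by apply/(represents_eq0 a0).
  have /cocycle_represents[y yb] : cdiff L n (b - i n a') = 0.
    by rewrite linearB -cmap_diff -aa' ba subrr.
  exists y; apply: (represents_coboundary_eq (cohomology_mapP p yb) xb).
  by rewrite linearB short_exact_comp subr0 subrr; exact: coboundary0.
have [b yb] := represents_ex y; apply/connectingP.
exists b, 0; rewrite linear0 (represents_cocycle yb); split=> //.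
  exact: cohomology_mapP.
exact: represents0.
Qed.

Lemma connecting_next_exact n : exact_at (connecting n) (cohomology_map i n.+1).
Proof.
move=> y; split=> [|[x <-]].
  have [a ya] := represents_ex y.
  move/(represents_eq0 (cohomology_mapP i ya)) => [b iab].
  have /cocycle_represents[x xb] : cdiff Q n (p n b) = 0.
    by rewrite -cmap_diff -iab short_exact_comp.
  by exists x; apply/connectingP; exists b, a.
have [b [a [_ ba da]]] := (connectingP x _).1 erefl.
by apply/(represents_eq0 (cohomology_mapP i da)); exists b.
Qed.

End LongExactSequence.

(** * Coinduced bimodules *)

Section Coinduced.
Context (k : fieldType) (A B : linear_category k) (X : A -> B -> lmodType k).

Section Carrier.
Context (a : A) (b : B).

(** The elements at [(a, b)] are the linear maps from
    [hom A a' a (x) hom B b b'] to [X a' b'], for all [a'] and [b']; bilinear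
    functions stand for linear maps on the tensor product. *)
Record coind_car := Coind {
  coind_fun :> forall a' b', hom A a' a -> hom B b b' -> X a' b';
  coind_linearl : forall a' b' l, linear (fun h => @coind_fun a' b' h l);
  coind_linearr : forall a' b' h, linear (@coind_fun a' b' h) }.

Lemma coind_ext (u v : coind_car) :
  (forall a' b' h l, u a' b' h l = v a' b' h l) -> u = v.
Proof.
case: u v => [u u1 u2] [v v1 v2] /= e.
have {}e : u = v.
  by do 2!apply: functional_extensionality_dep => ?; do 2!apply/funext => ?.
by case: _ / e v1 v2 => v1 v2; congr Coind; exact: Prop_irrelevance.
Qed.

Definition coind_zero : coind_car.
Proof.
exists (fun _ _ _ _ => 0).
- by move=> a' b' l c h h'; rewrite scaler0 addr0.
- by move=> a' b' h c l l'; rewrite scaler0 addr0.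
Defined.

Definition coind_comb (c : k) (u v : coind_car) : coind_car.
Proof.
exists (fun a' b' h l => c *: u a' b' h l + v a' b' h l).
- move=> a' b' l d h h'; rewrite !coind_linearl !scalerDr !scalerA [c * d]mulrC.
  exact: addrACA.
- move=> a' b' h d l l'; rewrite !coind_linearr !scalerDr !scalerA [c * d]mulrC.
  exact: addrACA.
Defined.

Definition coind_add (u v : coind_car) := coind_comb 1 u v.
Definition coind_scale (c : k) (u : coind_car) := coind_comb c u coind_zero.

HB.instance Definition _ := gen_eqMixin coind_car.
HB.instance Definition _ := gen_choiceMixin coind_car.

Fact coind_addA : associative coind_add.
Proof. by move=> f g h; apply: coind_ext => * /=; rewrite !scale1r addrA. Qed.
Fact coind_addC : commutative coind_add.
Proof. by move=> f g; apply: coind_ext => * /=; rewrite !scale1r addrC. Qed.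
Fact coind_add0 : left_id coind_zero coind_add.
Proof. by move=> f; apply: coind_ext => * /=; rewrite scale1r add0r. Qed.
Fact coind_addN : left_inverse coind_zero (coind_scale (-1)) coind_add.
Proof.
by move=> f; apply: coind_ext => * /=; rewrite addr0 scale1r scaleN1r addNr.
Qed.
HB.instance Definition _ := GRing.isZmodule.Build coind_car
  coind_addA coind_addC coind_add0 coind_addN.

Fact coind_scaleA c d f : coind_scale c (coind_scale d f) = coind_scale (c * d) f.
Proof. by apply: coind_ext => * /=; rewrite !addr0 scalerA. Qed.
Fact coind_scale1 : left_id 1 coind_scale.
Proof. by move=> f; apply: coind_ext => * /=; rewrite addr0 scale1r. Qed.
Fact coind_scaleDr : right_distributive coind_scale +%R.
Proof.
by move=> c f g; apply: coind_ext => * /=; rewrite !addr0 !scale1r scalerDr.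
Qed.
Fact coind_scaleDl f : {morph coind_scale^~ f : c d / c + d}.
Proof.
by move=> c d; apply: coind_ext => * /=; rewrite !addr0 scale1r scalerDl.
Qed.
HB.instance Definition _ := GRing.Zmodule_isLmodule.Build k coind_car
  coind_scaleA coind_scale1 coind_scaleDr coind_scaleDl.

Lemma coindP c (u v : coind_car) a' b' h l :
  (c *: u + v) a' b' h l = c *: u a' b' h l + v a' b' h l.
Proof. by rewrite /= addr0 scale1r. Qed.

Lemma coindD (u v : coind_car) a' b' h l : (u + v) a' b' h l = u a' b' h l + v a' b' h l.
Proof. by rewrite /= scale1r. Qed.

Lemma coindZ c (u : coind_car) a' b' h l : (c *: u) a' b' h l = c *: u a' b' h l.
Proof. by rewrite /= addr0. Qed.

End Carrier.

Definition coind_lact a' a b (f : hom A a' a) (u : coind_car a b) : coind_car a' b.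
Proof.
exists (fun a'' b'' h l => u a'' b'' (comp h f) l).
- by move=> a'' b'' l c h h'; rewrite comp_linearl coind_linearl.
- by move=> a'' b'' h; exact: coind_linearr.
Defined.

Definition coind_ract a b b' (u : coind_car a b) (g : hom B b b') : coind_car a b'.
Proof.
exists (fun a'' b'' h l => u a'' b'' h (comp g l)).
- by move=> a'' b'' l; exact: coind_linearl.
- by move=> a'' b'' h c l l'; rewrite comp_linearr coind_linearr.
Defined.

Definition coinduced : bimodule A B.
Proof.
exists (fun a b => coind_car a b : lmodType k) coind_lact coind_ract.
- move=> a' a b u c f g; apply: coind_ext => * /=.
  by rewrite addr0 scale1r comp_linearr coind_linearl.
- by move=> a' a b f c u v; apply: coind_ext => *.
- by move=> a b b' g c u v; apply: coind_ext => *.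
- move=> a b b' u c f g; apply: coind_ext => * /=.
  by rewrite addr0 scale1r comp_linearl coind_linearr.
- by move=> a b u; apply: coind_ext => * /=; rewrite compm1.
- by move=> a b u; apply: coind_ext => * /=; rewrite comp1m.
- by move=> *; apply: coind_ext => * /=; rewrite compA.
- by move=> *; apply: coind_ext => * /=; rewrite compA.
- by [].
Defined.

End Coinduced.

Section CoinducedUnit.
Context (k : fieldType) (A B : linear_category k) (N : bimodule A B).

Definition coind_unit : bimod_hom N (coinduced N).
Proof.
unshelve eexists.
- move=> a b n; exists (fun a' b' h l => ract N (lact N h n) l).
  + by move=> a' b' l c h h'; rewrite lact_linearl ract_linearl.
  + by move=> a' b' h; exact: ract_linearr.
- move=> a b c n n'; apply: coind_ext => * /=.
  by rewrite addr0 scale1r lact_linearr ract_linearl.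
- by move=> *; apply: coind_ext => * /=; rewrite lactA.
- by move=> *; apply: coind_ext => * /=; rewrite -lractA ractA.
Defined.

Definition coind_eval a b (u : coinduced N a b) : N a b := u a b (idm a) (idm b).

Lemma coind_eval_linear a b : linear (@coind_eval a b).
Proof. by move=> c u v; rewrite /coind_eval coindP. Qed.

Lemma coind_unitK a b (n : N a b) : coind_eval (coind_unit a b n) = n.
Proof. by rewrite /coind_eval /= lact1 ract1. Qed.

Lemma coind_homE (Q : bimodule A B) (u : bimod_hom Q (coinduced N)) a b q a' b' h l :
  u a b q a' b' h l = coind_eval (u a' b' (ract Q (lact Q h q) l)).
Proof. by rewrite bhom_ract bhom_lact /coind_eval /= comp1m compm1. Qed.

(** Coinduction is right adjoint to the functor forgetting the actions: every
    family of linear maps [v] comes from a unique bimodule homomorphism. *)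
Definition coind_adjunct (Q : bimodule A B) (v : forall a b, Q a b -> N a b)
    (v_linear : forall a b, linear (@v a b)) : bimod_hom Q (coinduced N).
Proof.
unshelve eexists.
- move=> a b q; exists (fun a' b' h l => v a' b' (ract Q (lact Q h q) l)).
  + by move=> a' b' l c h h'; rewrite lact_linearl ract_linearl v_linear.
  + by move=> a' b' h c l l'; rewrite ract_linearr v_linear.
- move=> a b c n n'; apply: coind_ext => * /=.
  by rewrite addr0 scale1r lact_linearr ract_linearl v_linear.
- by move=> *; apply: coind_ext => * /=; rewrite lactA.
- by move=> *; apply: coind_ext => * /=; rewrite -lractA ractA.
Defined.

End CoinducedUnit.

Lemma linear_funB (k : fieldType) (U V : lmodType k) (f : U -> V) :
  linear f -> {morph f : x y / x - y}.
Proof.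
move=> fL x y; have := fL (-1) y x.
by rewrite !scaleN1r => fxy; rewrite addrC fxy addrC.
Qed.

Lemma linear_funD (k : fieldType) (U V : lmodType k) (f : U -> V) :
  linear f -> {morph f : x y / x + y}.
Proof. by move=> fL x y; have := fL 1 x y; rewrite !scale1r. Qed.

Lemma linear_funN (k : fieldType) (U V : lmodType k) (f : U -> V) :
  linear f -> {morph f : x / - x}.
Proof.
by move=> fL x; rewrite -[in LHS]sub0r (linear_funB fL) (linear_fun0 fL) sub0r.
Qed.

(** * The cokernel of a linearly split monomorphism *)

(** When [i] has a family of linear retractions [r], the cokernel of [i] is, as a
    family of vector spaces, the kernel of [r]. Its actions are those of [N']
    followed by the projection [x |-> x - i (r x)]; working with a subspace in place
    of a quotient gives a linear section of the projection for free. *)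
Section SplitCokernel.
Context (k : fieldType) (A B : linear_category k) (N N' : bimodule A B).
Context (i : bimod_hom N N') (r : forall a b, N' a b -> N a b).
Hypothesis r_linear : forall a b, linear (@r a b).
Hypothesis rK : forall a b n, r (i a b n) = n.

Section Carrier.
Context (a : A) (b : B).

Definition retract_ker : pred (N' a b) := [pred x | r x == 0].

Fact retract_ker_closed : submod_closed retract_ker.
Proof.
split=> [|c x y]; rewrite !inE ?(linear_fun0 (@r_linear a b)) // => /eqP rx /eqP ry.
by rewrite r_linear rx ry scaler0 addr0.
Qed.
HB.instance Definition _ :=
  GRing.isSubmodClosed.Build k (N' a b) retract_ker retract_ker_closed.

Record split_coker_car := SplitCoker {
  split_coker_val :> N' a b;
  split_coker_valP : split_coker_val \in retract_ker }.

HB.instance Definition _ := [isSub for split_coker_val].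
HB.instance Definition _ := [Choice of split_coker_car by <:].
HB.instance Definition _ := [SubChoice_isSubZmodule of split_coker_car by <:].
HB.instance Definition _ := [SubZmodule_isSubLmodule of split_coker_car by <:].

Lemma split_coker_r (x : split_coker_car) : r x = 0.
Proof. by apply/eqP; exact: split_coker_valP. Qed.

Fact split_coker_proj_ker (x : N' a b) : x - i a b (r x) \in retract_ker.
Proof.
rewrite inE -scaleN1r addrC r_linear rK scaleN1r addNr.
by [].
Qed.

Definition split_coker_proj x : split_coker_car := SplitCoker (split_coker_proj_ker x).

Lemma split_coker_ext (x y : split_coker_car) : x = y :> N' a b -> x = y.
Proof. exact: val_inj. Qed.

Lemma split_coker_proj_linear : linear split_coker_proj.
Proof.
move=> c x y; apply: split_coker_ext => /=.
by rewrite r_linear bhom_linear opprD addrACA scalerBr.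
Qed.

Lemma split_coker_projK (x : split_coker_car) : split_coker_proj x = x.
Proof.
apply: split_coker_ext => /=.
by rewrite split_coker_r (linear_fun0 (bhom_linear i (a:=a) (b:=b))) subr0.
Qed.

Lemma split_coker_proj_eq0 (x : N' a b) :
  split_coker_proj x = 0 <-> exists n, i a b n = x.
Proof.
split=> [/(congr1 split_coker_val) /= /eqP|[n <-]].
  by rewrite subr_eq0 => /eqP ix; exists (r x).
by apply: split_coker_ext; rewrite /= rK subrr.
Qed.

Lemma split_coker_proj_eq (x y : N' a b) :
  (exists n, i a b n = x - y) -> split_coker_proj x = split_coker_proj y.
Proof.
move=> /split_coker_proj_eq0; rewrite (linear_funB split_coker_proj_linear) => /eqP.
by rewrite subr_eq0 => /eqP.
Qed.

End Carrier.

(** The projection does not change if [x] is modified by the image of [i], which is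
    stable under the action; this yields the associativity laws of the cokernel. *)
Lemma split_coker_lact a' a b (f : hom A a' a) (x : N' a b) :
  split_coker_proj (lact N' f (split_coker_proj x)) = split_coker_proj (lact N' f x).
Proof.
apply: split_coker_proj_eq; exists (- lact N f (r x)).
rewrite (linear_funN (bhom_linear i (a:=a') (b:=b))) bhom_lact /=.
by rewrite (linear_funB (lact_linearr f)) addrAC subrr add0r.
Qed.

Lemma split_coker_ract a b b' (x : N' a b) (g : hom B b b') :
  split_coker_proj (ract N' (split_coker_proj x) g) = split_coker_proj (ract N' x g).
Proof.
apply: split_coker_proj_eq; exists (- ract N (r x) g).
rewrite (linear_funN (bhom_linear i (a:=a) (b:=b'))) bhom_ract /=.
by rewrite (linear_funB (ract_linearl g)) addrAC subrr add0r.
Qed.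

Definition split_coker : bimodule A B.
Proof.
exists (fun a b => split_coker_car a b : lmodType k)
  (fun a' a b f (x : split_coker_car a b) => split_coker_proj (lact N' f x))
  (fun a b b' (x : split_coker_car a b) g => split_coker_proj (ract N' x g)).
- by move=> a' a b x c f g; rewrite lact_linearl split_coker_proj_linear.
- by move=> a' a b f c x y; rewrite lact_linearr split_coker_proj_linear.
- by move=> a b b' g c x y; rewrite ract_linearl split_coker_proj_linear.
- by move=> a b b' x c f g; rewrite ract_linearr split_coker_proj_linear.
- by move=> a b x; rewrite lact1 split_coker_projK.
- by move=> a b x; rewrite ract1 split_coker_projK.
- by move=> *; rewrite lactA split_coker_lact.
- by move=> *; rewrite ractA split_coker_ract.
- by move=> *; rewrite split_coker_lact split_coker_ract lractA.
Defined.

Definition split_coker_quot : bimod_hom N' split_coker.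
Proof.
exists (fun a b x => split_coker_proj x).
- exact: split_coker_proj_linear.
- by move=> *; rewrite /= split_coker_lact.
- by move=> *; rewrite /= split_coker_ract.
Defined.

End SplitCokernel.

(** * Functoriality of Hochschild-Mitchell cochains *)

(** [hm_tail] is built from values of the cochain by linear combinations and the
    right action only, hence it respects every family of relations that these
    operations respect. *)
Section TailRelation.
Context (k : fieldType) (A : linear_category k) (N N' : bimodule A A) (b b' : A).
Context (R : forall x, N b x -> N' b' x -> Prop).
Hypothesis R0 : forall x, R (0 : N b x) 0.
Hypothesis RL : forall x c (u v : N b x) (u' v' : N' b' x),
  R u u' -> R v v' -> R (c *: u + v) (c *: u' + v').
Hypothesis R_ract : forall x x' (g : hom A x x') (u : N b x) (u' : N' b' x),
  R u u' -> R (ract N u g) (ract N' u' g).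

Lemma hm_tail_rel n y (phi : forall x, chain n y x -> N b x)
    (psi : forall x, chain n y x -> N' b' x) :
  (forall x c, R (phi x c) (psi x c)) ->
  forall x c, R (@hm_tail k A N n b y phi x c) (@hm_tail k A N' n b' y psi x c).
Proof.
move=> phi_psi x c; rewrite /hm_tail addrC [X in R _ X]addrC.
case: (csplit c) => w [c' f]; apply: RL; first exact: R_ract.
apply: (big_rec2 (fun u u' => R u u')) => // i u u' _ uu'.
exact: RL.
Qed.

End TailRelation.

Section Coefficients.
Context (k : fieldType) (A : linear_category k).

Definition cochain_bhom (N N' : bimodule A A) (u : bimod_hom N N') n
    (phi : cochain N n) : cochain N' n :=
  Cochain (fun y x => multilinear_comp (bhom_linear u (a:=y) (b:=x))
                        (cochain_multilinear phi y x)).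

Lemma cochain_bhom_linear N N' u n : linear (@cochain_bhom N N' u n).
Proof. by move=> c phi psi; apply: cochain_ext => y x ch /=; rewrite bhom_linear. Qed.

HB.instance Definition _ N N' u n := GRing.isLinear.Build k (cochain N n) (cochain N' n)
  *:%R (@cochain_bhom N N' u n) (@cochain_bhom_linear N N' u n).

Lemma cochain_bhom_diff N N' u n (phi : cochain N n) :
  @cochain_bhom N N' u n.+1 (hm_diff phi) = hm_diff (cochain_bhom u phi).
Proof.
apply: cochain_ext => y x c /=; rewrite !hm_diff_tail.
case: c => w [f c].
have uD := linear_funD (bhom_linear u (a:=y) (b:=x)).
rewrite uD bhom_lact; congr (_ + _).
apply: (@hm_tail_rel k A N N' y y (fun x m m' => u y x m = m')) => //.
- by move=> x'; exact: linear_fun0 (bhom_linear u (a:=y) (b:=x')).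
- by move=> x' d m1 m2 m1' m2' <- <-; rewrite bhom_linear.
- by move=> x1 x2 g m m' <-; rewrite bhom_ract.
Qed.

Definition hm_bhom N N' u : chain_map (hm_complex N) (hm_complex N') :=
  @ChainMap k (hm_complex N) (hm_complex N')
    (fun n => @cochain_bhom N N' u n) (@cochain_bhom_diff N N' u).

(** Exactness is tested in each degree separately, where composing multilinear maps
    with the linear maps [r] and [s] provides the preimages. *)
Lemma hm_bhom_short_exact (N N' N'' : bimodule A A)
    (i : bimod_hom N N') (p : bimod_hom N' N'')
    (r : forall y x, N' y x -> N y x) (s : forall y x, N'' y x -> N' y x) :
  (forall y x, linear (@r y x)) -> (forall y x, linear (@s y x)) ->
  (forall y x m, r y x (i y x m) = m) ->
  (forall y x m, p y x (s y x m) = m) ->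
  (forall y x m, p y x m = 0 <-> exists n, i y x n = m) ->
  short_exact (hm_bhom i) (hm_bhom p).
Proof.
move=> r_lin s_lin rK sK ip; split=> [n phi psi e|n phi|n psi].
- apply: cochain_ext => y x c; rewrite -[LHS]rK -[RHS]rK; congr r.
  exact: (congr1 (fun f : cochain N' n => f y x c) e).
- split=> [e|[psi <-]].
    exists (Cochain (fun y x =>
      multilinear_comp (@r_lin y x) (cochain_multilinear phi y x))).
    apply: cochain_ext => y x c /=.
    have /ip[m <-] : p y x (phi y x c) = 0.
      exact: (congr1 (fun f : cochain N'' n => f y x c) e).
    by rewrite rK.
  by apply: cochain_ext => y x c /=; apply/ip; eexists.
- exists (Cochain (fun y x =>
    multilinear_comp (@s_lin y x) (cochain_multilinear psi y x))).
  by apply: cochain_ext => y x c /=; rewrite sK.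
Qed.

End Coefficients.

Section RestrictionMap.
Context (k : fieldType) (A A' : linear_category k) (F : linear_functor A' A).
Context (N : bimodule A A).

Fixpoint map_chain n (y x : A') : chain n y x -> chain n (F y) (F x) :=
  match n with
  | 0 => fun e => congr1 F e
  | m.+1 => fun '(existT w (f, c)) => ccons (fmap F f) (map_chain c)
  end.

Lemma map_chain_multilinear (V : lmodType k) n y x (phi : chain n (F y) (F x) -> V) :
  multilinear phi -> multilinear (fun c : chain n y x => phi (map_chain c)).
Proof.
elim: n y phi => [//|n IHn] y phi [p1 p2]; split=> [w c a f g|w f] /=.
  by rewrite fmap_linear p1.
exact: IHn (p2 _ _).
Qed.

Lemma map_chain_tail n b y (phi : forall x, chain n (F y) x -> N (F b) x) x
    (c : chain n.+1 y x) :
  @hm_tail k A' (restriction F F N) n b y (fun x c => phi (F x) (map_chain c)) x c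
    = @hm_tail k A N n (F b) (F y) phi (F x) (map_chain c).
Proof.
elim: n y phi c => [|n IHn] y phi [w [f c]].
  by case: _ / c; rewrite (@hm_tail0 k A' (restriction F F N)) (@hm_tail0 k A N).
case: c => v [g c]; rewrite [in RHS]/= -/(ccons f _) -/(ccons g _) !hm_tailS /=.
by rewrite fmapM (IHn w (fun x' c' => phi x' (ccons (fmap F f) c'))).
Qed.

Definition cochain_restrict n (phi : cochain N n) : cochain (restriction F F N) n :=
  @Cochain k A' (restriction F F N) n (fun y x c => phi (F y) (F x) (map_chain c))
    (fun y x => map_chain_multilinear (cochain_multilinear phi (F y) (F x))).

Lemma cochain_restrict_linear n : linear (@cochain_restrict n).
Proof. by move=> c phi psi; apply: cochain_ext. Qed.

HB.instance Definition _ n := GRing.isLinear.Build k (cochain N n)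
  (cochain (restriction F F N) n) *:%R (@cochain_restrict n) (@cochain_restrict_linear n).

Lemma cochain_restrict_diff n (phi : cochain N n) :
  cochain_restrict (hm_diff phi) = hm_diff (cochain_restrict phi).
Proof.
apply: cochain_ext => y x c; rewrite /= !hm_diff_tail map_chain_tail.
by case: c => w [f c].
Qed.

Definition hm_restrict : chain_map (hm_complex N) (hm_complex (restriction F F N)) :=
  @ChainMap k (hm_complex N) (hm_complex (restriction F F N)) _ cochain_restrict_diff.

End RestrictionMap.

(** * The restriction sequence of a gluing *)

Lemma rV0_eq (k : fieldType) (u v : 'rV[k]_0) : u = v.
Proof. by rewrite [u]thinmx0 [v]thinmx0. Qed.

Lemma chain0_irr (k : fieldType) (A : linear_category k) (y x : A)
    (c c' : chain 0 y x) : c = c'.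
Proof. exact: (@Prop_irrelevance (y = x)). Qed.

Section ExtensionByZero.
Context (k : fieldType) (C1 C2 : linear_category k) (M : bimodule C1 C2).

Section Module.
Context (X : bimodule C1 C2).

(** The bimodule [X] placed on the pairs (object of [C1], object of [C2]) and zero
    elsewhere. Since the only morphisms between the two categories go from [C2] to
    [C1], no action leaves these pairs except through a zero map. *)
Definition ext0_car (y x : gluing M) : lmodType k :=
  match y, x with inl a, inr b => X a b | _, _ => 'rV[k]_0 end.

Definition ext0_lact (z y x : gluing M) :
    hom (gluing M) z y -> ext0_car y x -> ext0_car z x :=
  match z, y, x return hom (gluing M) z y -> ext0_car y x -> ext0_car z x with
  | inl _, inl _, inr _ => fun f m => lact X f m
  | _, _, _ => fun _ _ => 0
  end.

Definition ext0_ract (z y x : gluing M) :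
    ext0_car z y -> hom (gluing M) y x -> ext0_car z x :=
  match z, y, x return ext0_car z y -> hom (gluing M) y x -> ext0_car z x with
  | inl _, inr _, inr _ => fun m g => ract X m g
  | _, _, _ => fun _ _ => 0
  end.

Definition ext0 : bimodule (gluing M) (gluing M).
Proof.
exists ext0_car ext0_lact ext0_ract.
- case=> z [] y [] x m c f g //=; rewrite ?scaler0 ?addr0 //; exact: lact_linearl.
- case=> z [] y [] x f c m n //=; rewrite ?scaler0 ?addr0 //; exact: lact_linearr.
- case=> z [] y [] x g c m n //=; rewrite ?scaler0 ?addr0 //; exact: ract_linearl.
- case=> z [] y [] x m c f g //=; rewrite ?scaler0 ?addr0 //; exact: ract_linearr.
- by case=> y [] x m /=; rewrite ?lact1 //; apply/rowP; case.
- by case=> y [] x m /=; rewrite ?ract1 //; apply/rowP; case.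
- by case=> t [] z [] y [] x f g m //=; rewrite ?lactA ?lactm0 ?lact0m.
- by case=> t [] z [] y [] x f g m //=; rewrite ?ractA ?ractm0 ?ract0m.
- by case=> t [] z [] y [] x f m g //=; rewrite ?lractA ?lactm0 ?ract0m.
Defined.

End Module.

Definition ext0_bhom (X Y : bimodule C1 C2) (u : bimod_hom X Y) :
  bimod_hom (ext0 X) (ext0 Y).
Proof.
exists (fun y x => match y, x return ext0 X y x -> ext0 Y y x with
  inl a, inr b => u a b | _, _ => fun _ => 0 end).
- by case=> y [] x c m n //=; rewrite ?scaler0 ?addr0 //; exact: bhom_linear.
- case=> z [] y [] x f m //=; rewrite ?bhom_lact ?lactm0 //.
  exact: linear_fun0 (bhom_linear u (a:=_) (b:=_)).
- case=> z [] y [] x m f //=; rewrite ?bhom_ract ?ract0m //.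
  exact: linear_fun0 (bhom_linear u (a:=_) (b:=_)).
Defined.

Section Inclusion.
Context (N : bimodule (gluing M) (gluing M)).

(** For the same reason the spaces [N (inl a) (inr b)] form a sub-bimodule of [N]. *)
Definition ext0_incl : bimod_hom (ext0 (r12 N)) N.
Proof.
exists (fun y x => match y, x return ext0 (r12 N) y x -> N y x with
  inl a, inr b => fun m => m | _, _ => fun _ => 0 end).
- by case=> y [] x c m n //=; rewrite ?scaler0 ?addr0.
- case=> z [] y [] x f m //=; rewrite ?lactm0 //.
  by rewrite [f]thinmx0 lact0m.
- case=> z [] y [] x m f //=; rewrite ?ract0m //.
  by rewrite [f]thinmx0 ractm0.
Defined.

End Inclusion.

Lemma hom_rl (w : C2) (v : C1) (f : hom (gluing M) (inr w) (inl v)) : f = 0.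
Proof. exact: thinmx0. Qed.

(** A chain from an object of [C1] to an object of [C2] contains a zero morphism. *)
Lemma multilinear_rl (V : lmodType k) n (w : C2) (v : C1)
    (phi : @chain k (gluing M) n (inr w) (inl v) -> V) :
  multilinear phi -> forall c, phi c = 0.
Proof.
elim: n w phi => [//|n IHn] w phi [p1 p2] [[u|u] [f c]].
  by rewrite [f]hom_rl; exact: linear_fun0 (p1 _ c).
exact: (IHn _ _ (p2 _ f)).
Qed.

(** A chain with both ends in [C1] that leaves [C1] contains a morphism from [C1] to
    [C2], where a multilinear map has to vanish; so extension by zero is the only
    multilinear extension. *)
Fixpoint extend_inl (V : lmodType k) (x : C1) n : forall y : C1,
    (chain n y x -> V) -> @chain k (gluing M) n (inl y) (inl x) -> V :=
  match n with
  | 0 => fun y phi e => phi (inl_inj e)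
  | m.+1 => fun y phi '(existT w (f, c)) =>
      match w return hom (gluing M) (inl y) w -> @chain k (gluing M) m w (inl x) -> V with
      | inl w' => fun f c => extend_inl (fun c' => phi (ccons (f : hom C1 y w') c')) c
      | inr _ => fun _ _ => 0
      end f c
  end.

Fixpoint extend_inr (V : lmodType k) (x : C2) n : forall y : C2,
    (chain n y x -> V) -> @chain k (gluing M) n (inr y) (inr x) -> V :=
  match n with
  | 0 => fun y phi e => phi (inr_inj e)
  | m.+1 => fun y phi '(existT w (f, c)) =>
      match w return hom (gluing M) (inr y) w -> @chain k (gluing M) m w (inr x) -> V with
      | inl _ => fun _ _ => 0
      | inr w' => fun f c => extend_inr (fun c' => phi (ccons (f : hom C2 y w') c')) c
      end f c
  end.

Lemma extend_inlP (V : lmodType k) (x : C1) n (y : C1) (a : k)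
    (phi psi : chain n y x -> V) c :
  extend_inl (fun c => a *: phi c + psi c) c = a *: extend_inl phi c + extend_inl psi c.
Proof.
elim: n y phi psi c => [//|n IHn] y phi psi [[w|w] [f c]] /=; first exact: IHn.
by rewrite scaler0 addr0.
Qed.

Lemma extend_inrP (V : lmodType k) (x : C2) n (y : C2) (a : k)
    (phi psi : chain n y x -> V) c :
  extend_inr (fun c => a *: phi c + psi c) c = a *: extend_inr phi c + extend_inr psi c.
Proof.
elim: n y phi psi c => [//|n IHn] y phi psi [[w|w] [f c]] /=; last exact: IHn.
by rewrite scaler0 addr0.
Qed.

Lemma extend_inl_multilinear (V : lmodType k) (x : C1) n (y : C1)
    (phi : chain n y x -> V) :
  multilinear phi -> multilinear (extend_inl phi).
Proof.
elim: n y phi => [//|n IHn] y phi [p1 p2]; split=> [[w|w] c a f g|[w|w] f] /=.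
- rewrite -extend_inlP; congr extend_inl; apply/funext => c'; exact: p1.
- by rewrite scaler0 addr0.
- exact/IHn/p2.
- exact: multilinear0.
Qed.

Lemma extend_inr_multilinear (V : lmodType k) (x : C2) n (y : C2)
    (phi : chain n y x -> V) :
  multilinear phi -> multilinear (extend_inr phi).
Proof.
elim: n y phi => [//|n IHn] y phi [p1 p2]; split=> [[w|w] c a f g|[w|w] f] /=.
- by rewrite scaler0 addr0.
- rewrite -extend_inrP; congr extend_inr; apply/funext => c'; exact: p1.
- exact: multilinear0.
- exact/IHn/p2.
Qed.

Lemma extend_inlK (V : lmodType k) (x : C1) n (y : C1) (phi : chain n y x -> V) c :
  extend_inl phi (map_chain (glue_inl M) c) = phi c.
Proof.
elim: n y phi c => [|n IHn] y phi; first by move=> e /=; congr phi; exact: chain0_irr.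
by case=> w [f c] /=; rewrite IHn.
Qed.

Lemma extend_inrK (V : lmodType k) (x : C2) n (y : C2) (phi : chain n y x -> V) c :
  extend_inr phi (map_chain (glue_inr M) c) = phi c.
Proof.
elim: n y phi c => [|n IHn] y phi; first by move=> e /=; congr phi; exact: chain0_irr.
by case=> w [f c] /=; rewrite IHn.
Qed.

(** A chain with both ends in [C1] either stays in [C1] or contains a zero
    morphism. *)
Lemma multilinear_ll (V : lmodType k) n (y x : C1)
    (phi : @chain k (gluing M) n (inl y) (inl x) -> V) :
  multilinear phi -> (forall c, phi (map_chain (glue_inl M) c) = 0) ->
  forall c, phi c = 0.
Proof.
elim: n y phi => [|n IHn] y phi.
  move=> _ phi0 e; rewrite -(phi0 (inl_inj e)); congr phi; exact: chain0_irr.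
move=> [p1 p2] phi0 [[w|w] [f c]]; last exact: multilinear_rl (p2 _ f) c.
by apply: (IHn _ _ (p2 _ f)) => c'; exact: (phi0 (ccons (f : hom C1 y w) c')).
Qed.

(** A chain with both ends in [C2] either stays in [C2] or contains a zero
    morphism. *)
Lemma multilinear_rr (V : lmodType k) n (y x : C2)
    (phi : @chain k (gluing M) n (inr y) (inr x) -> V) :
  multilinear phi -> (forall c, phi (map_chain (glue_inr M) c) = 0) ->
  forall c, phi c = 0.
Proof.
elim: n y phi => [|n IHn] y phi.
  move=> _ phi0 e; rewrite -(phi0 (inr_inj e)); congr phi; exact: chain0_irr.
move=> [p1 p2] phi0 [[w|w] [f c]].
  by rewrite [f]hom_rl; exact: linear_fun0 (p1 _ c).
by apply: (IHn _ _ (p2 _ f)) => c'; exact: (phi0 (ccons (f : hom C2 y w) c')).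
Qed.

End ExtensionByZero.

Section ProductComplex.
Context (k : fieldType) (K L : cochain_complex k).

Definition prod_diff n (x : K n * L n) : K n.+1 * L n.+1 :=
  (cdiff K n x.1, cdiff L n x.2).

Lemma prod_diff_linear n : linear (@prod_diff n).
Proof. by move=> c x y; rewrite /prod_diff !linearP. Qed.
HB.instance Definition _ n := GRing.isLinear.Build k (K n * L n)%type
  (K n.+1 * L n.+1)%type *:%R (@prod_diff n) (@prod_diff_linear n).

Lemma prod_diffK n (x : K n * L n) : prod_diff (prod_diff x) = 0.
Proof. by rewrite /prod_diff /= !cdiffK. Qed.

Definition prod_complex : cochain_complex k :=
  @CochainComplex k (fun n => (K n * L n)%type) (fun n => @prod_diff n) prod_diffK.

Lemma prod_complex_iso n :
  isomorphic (cohomology prod_complex n) (cohomology K n * cohomology L n)%type.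
Proof.
apply: (@linear_relation_iso _ _ _ (fun x y =>
  exists a : prod_complex n,
    [/\ represents x a, represents y.1 a.1 & represents y.2 a.2])).
- split; first by exists 0; split; exact: represents0.
  move=> c x y x' y' [a [xa ya1 ya2]] [a' [xa' ya1' ya2']].
  by exists (c *: a + a'); split; exact: represents_comb.
- move=> [y1 y2] [a [/represents_eq0 a0 ya1 ya2]]; have {}a0 := a0.1 erefl.
  have -> : y1 = 0.
    apply/(represents_eq0 ya1); case: n a a0 {y1 y2 ya1 ya2} => [|n] a /=.
      by move=> ->.
    by case=> b ->; exists b.1.
  have -> : y2 = 0.
    apply/(represents_eq0 ya2); case: n a a0 {y1 y2 ya1 ya2} => [|n] a /=.
      by move=> ->.
    by case=> b ->; exists b.2.
  by [].
- move=> x [a [xa /represents_eq0 a10 /represents_eq0 a20]].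
  have {}a10 := a10.1 erefl; have {}a20 := a20.1 erefl; apply/(represents_eq0 xa).
  case: n a a10 a20 {x xa} => [|n] [a1 a2] /=; first by move=> -> ->.
  by move=> [b1 ->] [b2 ->]; exists (b1, b2).
- move=> x; have [a xa] := represents_ex x.
  have da := represents_cocycle xa.
  have /cocycle_represents[y1 y1a] : cdiff K n a.1 = 0 by exact: (congr1 fst da).
  have /cocycle_represents[y2 y2a] : cdiff L n a.2 = 0 by exact: (congr1 snd da).
  by exists (y1, y2), a.
- move=> [y1 y2]; have [a1 ya1] := represents_ex y1; have [a2 ya2] := represents_ex y2.
  have /cocycle_represents[x xa] : cdiff prod_complex n (a1, a2) = 0.
    by rewrite /= /prod_diff (represents_cocycle ya1) (represents_cocycle ya2).
  by exists x, (a1, a2).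
Qed.

End ProductComplex.

Section GluingSequence.
Context (k : fieldType) (C1 C2 : linear_category k) (M : bimodule C1 C2).
Context (N : bimodule (gluing M) (gluing M)).

Definition glue_restrict_fun n (phi : hm_complex N n) :
    prod_complex (hm_complex (r1 N)) (hm_complex (r2 N)) n :=
  (hm_restrict (glue_inl M) N n phi, hm_restrict (glue_inr M) N n phi).

Lemma glue_restrict_linear n : linear (@glue_restrict_fun n).
Proof. by move=> c phi psi; rewrite /glue_restrict_fun !linearP. Qed.
HB.instance Definition _ n := GRing.isLinear.Build k _ _ *:%R
  (@glue_restrict_fun n) (@glue_restrict_linear n).

Lemma glue_restrict_diff n (phi : hm_complex N n) :
  glue_restrict_fun (cdiff _ n phi) =
  cdiff (prod_complex (hm_complex (r1 N)) (hm_complex (r2 N))) n (glue_restrict_fun phi).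
Proof. by rewrite /glue_restrict_fun !cmap_diff. Qed.

Definition glue_restrict : chain_map (hm_complex N)
    (prod_complex (hm_complex (r1 N)) (hm_complex (r2 N))) :=
  @ChainMap k (hm_complex N) (prod_complex (hm_complex (r1 N)) (hm_complex (r2 N)))
    (fun n => @glue_restrict_fun n) glue_restrict_diff.

(** A cochain whose restrictions vanish is zero on all chains except those from [C2]
    to [C1], where its values are elements of [r12 N]. *)
Lemma gluing_short_exact : short_exact (hm_bhom (ext0_incl N)) glue_restrict.
Proof.
split=> [n phi psi e|n phi|n [psi1 psi2]].
- apply: cochain_ext; move=> [y|y] [x|x] c; try exact: rV0_eq.
  exact: (congr1 (fun f : cochain N n => f (inl y) (inr x) c) e).
- split=> [e|[psi <-]].
    have m_phi := cochain_multilinear phi.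
    have e1 := congr1 (@fst (cochain (r1 N) n) (cochain (r2 N) n)) e.
    have e2 := congr1 (@snd (cochain (r1 N) n) (cochain (r2 N) n)) e.
    unshelve eexists.
      exists (fun y x => match y as y0, x as x0
        return @chain k (gluing M) n y0 x0 -> ext0 M (r12 N) y0 x0 with
        | inl y, inr x => phi (inl y) (inr x) | _, _ => fun _ => 0 end).
      by move=> [y|y] [x|x]; try exact: multilinear0; exact: m_phi.
    apply: cochain_ext; move=> [y|y] [x|x] c //=; apply: esym.
    + apply: multilinear_ll (m_phi _ _) _ c => c.
      exact: (congr1 (fun f : cochain (r1 N) n => f y x c) e1).
    + exact: multilinear_rl (m_phi _ _) c.
    + apply: multilinear_rr (m_phi _ _) _ c => c.
      exact: (congr1 (fun f : cochain (r2 N) n => f y x c) e2).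
  by congr pair; apply: cochain_ext.
- unshelve eexists.
    exists (fun y x => match y as y0, x as x0
      return @chain k (gluing M) n y0 x0 -> N y0 x0 with
      | inl y, inl x => extend_inl (psi1 y x)
      | inr y, inr x => extend_inr (psi2 y x) | _, _ => fun _ => 0 end).
    move=> [y|y] [x|x]; try exact: multilinear0.
      exact/extend_inl_multilinear/cochain_multilinear.
    exact/extend_inr_multilinear/cochain_multilinear.
  by congr pair; apply: cochain_ext => y x c /=; rewrite ?extend_inlK ?extend_inrK.
Qed.

End GluingSequence.

(** * Acyclicity of coinduced coefficients on a gluing *)

Section AppendChain.
Context (k : fieldType) (A : linear_category k).

Fixpoint crcons n : forall y x x' : A, chain n y x -> hom A x x' -> chain n.+1 y x' :=
  match n with
  | 0 => fun y x x' e =>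
      match e in _ = z return hom A z x' -> chain 1 y x' with
      | erefl => fun g => ccons g (erefl x' : chain 0 x' x')
      end
  | m.+1 => fun y x x' '(existT w (f, c)) g => ccons f (crcons c g)
  end.

Lemma multilinear_crconsl (V : lmodType k) n y x x' (phi : chain n.+1 y x' -> V)
    (g : hom A x x') :
  multilinear phi -> multilinear (fun c : chain n y x => phi (crcons c g)).
Proof.
elim: n y phi => [//|n IHn] y phi [p1 p2]; split=> [w c a f f'|w f] /=; first exact: p1.
exact: (IHn w (fun c => phi (ccons f c)) (p2 w f)).
Qed.

Lemma multilinear_crconsr (V : lmodType k) n y x x' (phi : chain n.+1 y x' -> V)
    (c : chain n y x) :
  multilinear phi -> linear (fun g : hom A x x' => phi (crcons c g)).
Proof.
elim: n y phi c => [|n IHn] y phi.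
  by move=> c [p1 p2]; case: _ / c => a f f' /=; exact: p1.
by case=> w [f c] [p1 p2] /=; exact: (IHn w (fun c => phi (ccons f c)) c (p2 w f)).
Qed.

End AppendChain.

Lemma chainS_ind (k : fieldType) (A : linear_category k) n (y x : A)
    (P : chain n.+1 y x -> Prop) :
  (forall w f (c : chain n w x), P (ccons f c)) -> forall c, P c.
Proof. by move=> Pcons [w [f c]]; exact: Pcons. Qed.

Lemma hm_diffE (k : fieldType) (A : linear_category k) (N : bimodule A A) n
    (phi : cochain N n) (y w x : A) (f : hom A y w) (c : chain n w x) :
  hm_diff phi y x (ccons f c) = lact N f (phi w x c) + hm_tail (phi y) (ccons f c).
Proof. exact: hm_diff_tail. Qed.

Section CoinducedAcyclic.
Context (k : fieldType) (C1 C2 : linear_category k) (M : bimodule C1 C2).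
Context (Y : C1 -> C2 -> lmodType k).
Let G := gluing M.
Let X := coinduced Y.
Let X0 := ext0 M X.

Lemma multilinear_coind n (y x : G) a b (phi : chain n y x -> X a b) :
  (forall a' b' h l, multilinear (fun c => phi c a' b' h l)) -> multilinear phi.
Proof.
elim: n y phi => [//|n IHn] y phi m_phi; split=> [w c t f g|w f].
  apply: coind_ext => a' b' h l; rewrite coindP.
  by have [p1 _] := m_phi a' b' h l; exact: p1.
by apply: IHn => a' b' h l; have [_ p2] := m_phi a' b' h l; exact: p2.
Qed.

Lemma coind_at_linear a b a' b' h l : linear (fun u : X a b => u a' b' h l).
Proof. by move=> c u v; rewrite coindP. Qed.

Section Left.
Context (n : nat) (F : cochain X0 n.+1).

(** The usual contraction of the bar complex with coefficients in a coinduced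
    module: [(s F)(c)(h, l) = F(h, c)(1, l)]. *)
Definition insert_left_val (y : C1) (x : C2) (c : @chain k G n (inl y) (inr x)) : X y x.
Proof.
exists (fun a' b' h l =>
  (F (inl a') (inr x) (ccons (h : hom G (inl a') (inl y)) c) : X a' x) a' b' (idm a') l).
- move=> a' b' l t h h'; have [p1 _] := cochain_multilinear F (inl a') (inr x).
  by rewrite p1 coindP.
- by move=> a' b' h; exact: coind_linearr.
Defined.

Definition insert_left_fun (y x : G) : chain n y x -> X0 y x :=
  match y as y0, x as x0 return @chain k G n y0 x0 -> X0 y0 x0 with
  | inl y, inr x => @insert_left_val y x
  | _, _ => fun _ => 0
  end.

Lemma insert_left_multilinear (y x : G) : multilinear (@insert_left_fun y x).
Proof.
case: y x => y [] x; try exact: multilinear0.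
apply: multilinear_coind => a' b' h l /=.
apply: (multilinear_comp (@coind_at_linear a' x a' b' (idm a') l)).
by have [_ p2] := cochain_multilinear F (inl a') (inr x); exact: p2.
Qed.

Definition insert_left : cochain X0 n := Cochain insert_left_multilinear.

Hypothesis dF : hm_diff F = 0.

Lemma insert_left_tail (y : C1) (x : C2) (c : @chain k G n.+1 (inl y) (inr x))
    a' b' (h : hom C1 a' y) l :
  (hm_tail (insert_left (inl y)) c : X y x) a' b' h l =
  (hm_tail (fun x' c' => F (inl a') x' (ccons (h : hom G (inl a') (inl y)) c')) c
     : X a' x) a' b' (idm a') l.
Proof.
pose R (x : G) : X0 (inl y) x -> X0 (inl a') x -> Prop :=
  match x return X0 (inl y) x -> X0 (inl a') x -> Prop with
  | inl _ => fun _ _ => True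
  | inr x => fun u v => forall b' l, (u : X y x) a' b' h l = (v : X a' x) a' b' (idm a') l
  end.
suff: R (inr x) (hm_tail (insert_left (inl y)) c)
  (hm_tail (fun x' c' => F (inl a') x' (ccons (h : hom G (inl a') (inl y)) c')) c).
  by apply.
apply: (@hm_tail_rel k G X0 X0 (inl y) (inl a') R _ _ _ n (inl y)
  (insert_left (inl y))
  (fun x' c' => F (inl a') x' (ccons (h : hom G (inl a') (inl y)) c')) _ (inr x) c).
- by case.
- by case=> // z t u v u' v' uu' vv' b'' l'; rewrite !coindP uu' vv'.
- by case=> [z|z] [z'|z'] g u u' //= uu' b'' l'; rewrite uu'.
- by case.
Qed.

(** The identity [d s + s d = 1] for a cocycle, on the chains that start with a
    morphism [f] of [C1]. It is obtained by evaluating [(d F)(h, f, c) = 0] at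
    [(1, l)]. On chains that start with an element of [M] it fails: the term
    [f (s F)(c)] is then zero, because [ext0] vanishes on pairs of objects of [C2],
    whereas the corresponding term [F(h f, c)(1, l)] need not be. *)
Lemma insert_left_homotopy (y w : C1) (x : G) (f : hom G (inl y) (inl w))
    (c : @chain k G n (inl w) x) :
  hm_diff insert_left (inl y) x (ccons f c) = F (inl y) x (ccons f c).
Proof.
case: x c => x c; first exact: rV0_eq.
apply: coind_ext => a' b' h l.
have split_diff (u p t : X a' x) : 0 = u + (- p - t) ->
    p a' b' (idm a') l + t a' b' (idm a') l = u a' b' (idm a') l.
  by move=> /esym/eqP; rewrite -opprD subr_eq0 => /eqP ->; rewrite coindD.
have add_at (u p t : X y x) : u = p + t -> u a' b' h l = p a' b' h l + t a' b' h l.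
  by move=> ->; rewrite coindD.
have := hm_diffE F (h : hom G (inl a') (inl y)) (ccons f c).
rewrite dF hm_tailS => /split_diff e1.
have := add_at _ _ _ (hm_diffE insert_left f c); rewrite insert_left_tail => e2.
apply: (etrans e2); apply: (etrans e1).
exact: (congr1 (fun g => (F (inl y) (inr x) (ccons f c) : X y x) a' b' g l) (comp1m h)).
Qed.

End Left.


Lemma coind_at_subN a b a' b' h l (u v w : X a b) :
  u = - v - w -> u a' b' h l = - (v a' b' h l) - w a' b' h l.
Proof.
move=> ->; rewrite (linear_funB (@coind_at_linear a b a' b' h l)).
by rewrite (linear_funN (@coind_at_linear a b a' b' h l)).
Qed.

Lemma coind_at_opp a b a' b' h l (u v : X a b) :
  u = - v -> u a' b' h l = - v a' b' h l.
Proof. by move=> ->; exact: (linear_funN (@coind_at_linear a b a' b' h l)). Qed.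

Lemma coind_at_addN a b a' b' h l (u v w : X a b) :
  u = - v + w -> u a' b' h l = - (v a' b' h l) + w a' b' h l.
Proof.
move=> ->; rewrite coindD.
by rewrite (linear_funN (@coind_at_linear a b a' b' h l)).
Qed.

(** Here [psi] is [phi] after insertion at the right:
    [psi(c)(h, l) = phi(c, l)(h, 1)]. The last two terms of the differential of [phi]
    at [(c, l)] are the composition of the last morphism [g] of [c] with [l], which
    becomes the right action of [g] on [psi], and the right action of [l], which
    evaluated at [(h, 1)] gives back [phi(c)(h, l)]. If [g] is an element of [M], the
    right action of [g] on [psi] is zero, so one needs that [phi] vanishes on the
    chains whose last morphism is an element of [M]. *)
Lemma insert_right_tail n (b : C1) (y : G)
    (phi : forall x, @chain k G n.+1 y x -> X0 (inl b) x)
    (psi : forall x, @chain k G n y x -> X0 (inl b) x) :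
  (forall (x : C2) c a' b' h l, (psi (inr x) c : X b x) a' b' h l =
     (phi (inr b') (crcons c (l : hom G (inr x) (inr b'))) : X b b') a' b' h (idm b')) ->
  (forall (v : C1) (x : C2) c (g : hom G (inl v) (inr x)),
     phi (inr x) (crcons c g) = 0) ->
  forall (x : C2) c a' b' h l,
    (hm_tail phi (crcons c (l : hom G (inr x) (inr b'))) : X b b') a' b' h (idm b') =
    (hm_tail psi c : X b x) a' b' h l + (-1) ^+ n *: (phi (inr x) c : X b x) a' b' h l.
Proof.
elim: n y phi psi => [|n IHn] y phi psi psiE phi0 x [w [f c]] a' b' h l.
  case: w f c => [w|w] f c; first by [].
  have ewx : w = x := inr_inj c.
  move: f c; rewrite ewx => f c; rewrite (chain0_irr c erefl) {c ewx w}.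
  pose lG : hom G (inr x) (inr b') := l.
  have e1 : hm_tail phi (ccons f (ccons lG (erefl : chain 0 _ _))) =
     - phi _ (ccons (comp f lG) (erefl : chain 0 _ _))
     + ract X0 (phi _ (ccons f (erefl : chain 0 _ _))) lG.
    by rewrite hm_tailS hm_tail0 opprK.
  have e2 : (hm_tail psi (ccons f (erefl : chain 0 _ _)) : X b x) a' b' h l =
     - (phi _ (ccons (comp f lG) (erefl : chain 0 _ _)) : X b b') a' b' h (idm b').
    have e := @coind_at_opp b x a' b' h l _ _ (hm_tail0 psi f); apply: (etrans e).
    congr (- _); case: y f phi psi psiE phi0 {e1 e} => y f phi psi psiE phi0 /=.
      by have /= -> := phi0 y b' erefl (comp f lG).
    exact: psiE.
  rewrite [X in _ = X + _]e2 expr0 scale1r.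
  apply: (etrans (@coind_at_addN b b' a' b' h (idm b') _ _ _ e1)).
  by congr (_ + _); rewrite /= compm1.
case: c => v [g c]; rewrite -/(ccons g c) -/(ccons f (ccons g c)).
pose lG : hom G (inr x) (inr b') := l.
have e1 : hm_tail phi (crcons (ccons f (ccons g c)) lG) =
    - phi _ (ccons (comp f g) (crcons c lG))
    - hm_tail (fun x c => phi x (ccons f c)) (crcons (ccons g c) lG).
  exact: hm_tailS.
have e2 := hm_tailS psi f g c.
rewrite [X in _ = X + _](@coind_at_subN b x a' b' h l _ _ _ e2).
apply: (etrans (@coind_at_subN b b' a' b' h (idm b') _ _ _ e1)).
rewrite (IHn _ _ (fun x c => psi x (ccons f c))).
- by rewrite psiE exprS mulN1r scaleNr opprD addrA.
- by move=> x' c' a'' b'' h' l'; rewrite psiE.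
- by move=> v' x' c' g'; exact: (phi0 v' x' (ccons f c') g').
Qed.

Section Right.
Context (n : nat) (F : cochain X0 n.+1).

(** The contraction on the other side: [(t F)(c)(h, l) = F(c, l)(h, 1)]. *)
Definition insert_right_val (y : C1) (x : C2) (c : @chain k G n (inl y) (inr x)) : X y x.
Proof.
exists (fun a' b' h l =>
  (F (inl y) (inr b') (crcons c (l : hom G (inr x) (inr b'))) : X y b') a' b' h (idm b')).
- by move=> a' b' l; exact: coind_linearl.
- move=> a' b' h t l l'.
  have lin := @multilinear_crconsr k G _ n (inl y) (inr x) (inr b') _ c
    (cochain_multilinear F (inl y) (inr b')).
  apply: (etrans (congr1 (fun u : X y b' => u a' b' h (idm b')) (lin t l l'))).
  exact: (@coind_at_linear y b' a' b' h (idm b')).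
Defined.

Definition insert_right_fun (y x : G) : chain n y x -> X0 y x :=
  match y as y0, x as x0 return @chain k G n y0 x0 -> X0 y0 x0 with
  | inl y, inr x => @insert_right_val y x
  | _, _ => fun _ => 0
  end.

Lemma insert_right_multilinear (y x : G) : multilinear (@insert_right_fun y x).
Proof.
case: y x => y [] x; try exact: multilinear0.
apply: multilinear_coind => a' b' h l /=.
apply: (multilinear_comp (@coind_at_linear y b' a' b' h (idm b'))).
exact: (@multilinear_crconsl k G _ n (inl y) (inr x) (inr b') _
  (l : hom G (inr x) (inr b')) (cochain_multilinear F (inl y) (inr b'))).
Qed.

Definition insert_right : cochain X0 n := Cochain insert_right_multilinear.

End Right.

(** If [F] vanishes on the chains that start with a morphism of [C1], then so does
    [t F], and the only chains that remain start with an element of [M] and continue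
    in [C2]; since they have length at least two, they end with a morphism of [C2],
    where [t] is a contraction up to sign. *)
Lemma insert_right_homotopy n (F : cochain X0 n.+2) : hm_diff F = 0 ->
  (forall (y w : C1) (x : G) (f : hom G (inl y) (inl w)) (c : @chain k G n.+1 (inl w) x),
    F (inl y) x (ccons f c) = 0) ->
  hm_diff (insert_right F) = (-1) ^+ n *: F.
Proof.
move=> dF F0; apply: cochain_ext => y x c.
case: y x c => y [] x c; try exact: rV0_eq.
apply: coind_ext => a' b' h l; elim/chainS_ind: c => w f c.
pose lG : hom G (inr x) (inr b') := l.
have F_crcons0 (v : C1) (x' : C2) (c' : @chain k G n.+1 (inl y) (inl v))
    (g : hom G (inl v) (inr x')) :
    F (inl y) (inr x') (crcons c' g) = 0.
  (* If the first morphism of [c'] is an element of [M], then the rest of [c'] goes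
     from [C1] to [C2] and contains a zero morphism. *)
  case: c' => [[u|u] [f' c']]; first exact: F0.
  have [_ p2] := cochain_multilinear F (inl y) (inr x').
  exact: (multilinear_rl (@multilinear_crconsl k G _ n (inr u) (inl v) (inr x')
    (fun c => F (inl y) (inr x') (ccons f' c)) g (p2 _ f')) c').
have e1 := hm_diffE F f (crcons c lG); rewrite dF in e1.
have e2 := hm_diffE (insert_right F) f c.
have e3 := @insert_right_tail n.+1 y (inl y) (F (inl y)) (insert_right F (inl y))
  (fun _ _ _ _ _ _ => erefl) F_crcons0 x (ccons f c) a' b' h l.
have e4 : (lact X0 f (insert_right F w (inr x) c) : X y x) a' b' h l =
    (lact X0 f (F w (inr b') (crcons c lG)) : X y b') a' b' h (idm b').
  by clear; case: w f c.
have addE (b : C2) l' (u v w' : X y b) :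
    u = v + w' -> u a' b' h l' = v a' b' h l' + w' a' b' h l'.
  by move=> ->; rewrite coindD.
apply: (etrans (@addE _ l _ _ _ e2)); rewrite e4.
have {e1} := @addE _ (idm b') _ _ _ e1; rewrite [in X in _ = _ + X -> _]e3.
move=> /esym/eqP; rewrite addrA addr_eq0 => /eqP ->.
by rewrite -scaleNr exprS mulN1r opprK; apply: esym; exact: coindZ.
Qed.

(** Subtracting [d (s F)] makes a cocycle vanish on the chains that start with a
    morphism of [C1], and then [t] applies. The degree is at least two: in degree one
    the cocycles are the homomorphisms from [M], and the only coboundary is zero. *)
Theorem ext0_coinduced_acyclic n (F : cochain X0 n.+2) :
  hm_diff F = 0 -> exists E : cochain X0 n.+1, F = hm_diff E.
Proof.
move=> dF; pose F' : cochain X0 n.+2 := F - hm_diff (insert_left F).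
have dF' : hm_diff F' = 0 by rewrite linearB /= dF hm_diffK subrr.
have F'0 (y w : C1) (x : G) (f : hom G (inl y) (inl w)) (c : @chain k G n.+1 (inl w) x) :
    F' (inl y) x (ccons f c) = 0.
  rewrite /F' -scaleN1r addrC.
  have -> : (-1 *: hm_diff (insert_left F) + F) (inl y) x (ccons f c) =
    -1 *: hm_diff (insert_left F) (inl y) x (ccons f c) + F (inl y) x (ccons f c) by [].
  by rewrite insert_left_homotopy // scaleN1r addNr.
exists (insert_left F + (-1) ^+ n *: insert_right F').
rewrite linearD linearZ /= (insert_right_homotopy dF' F'0) scalerA -expr2 sqrr_sign.
by rewrite scale1r /F' addrC subrK.
Qed.

End CoinducedAcyclic.

(** * Dimension shifting *)

Section CohomologyFromCocycles.
Context (k : fieldType).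

Lemma cocycle_family_iso (V : lmodType k) (K : cochain_complex k) n (g : V -> K n) :
  linear g -> (forall v, cdiff K n (g v) = 0) ->
  (forall v, is_coboundary (g v) -> v = 0) ->
  (forall a, cdiff K n a = 0 -> exists v, g v = a) ->
  exists (f : {linear V -> cohomology K n}) (h : {linear cohomology K n -> V}),
    [/\ cancel f h, cancel h f & forall v, represents (f v) (g v)].
Proof.
move=> g_lin gK g_inj g_surj; have g0 := linear_fun0 g_lin.
apply: (@linear_relation_inverse k V (cohomology K n) (fun v x => represents x (g v))).
- split; first by rewrite g0; exact: represents0.
  by move=> c v x v' x' vx vx'; rewrite g_lin; exact: represents_comb.
- by move=> x; rewrite g0 => x0; apply/(represents_eq0 x0)/coboundary0.
- by move=> v /represents_eq0 gv; exact/g_inj/gv.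
- by move=> v; exact: cocycle_represents.
- move=> x; have [a xa] := represents_ex x.
  by have [v gv] := g_surj _ (represents_cocycle xa); exists v; rewrite gv.
Qed.

Definition acyclic_at (K : cochain_complex k) n : Prop :=
  forall a : K n, cdiff K n a = 0 -> is_coboundary a.

Lemma acyclic_cohomology (K : cochain_complex k) n (x : cohomology K n) :
  acyclic_at K n -> x = 0.
Proof.
have [a xa] := represents_ex x => acK.
by apply/(represents_eq0 xa)/acK/represents_cocycle/xa.
Qed.

Context (K L Q : cochain_complex k) (i : chain_map K L) (p : chain_map L Q).
Hypothesis ip : short_exact i p.

Lemma connecting_surj n : acyclic_at L n.+1 ->
  forall y, exists x, connecting ip n x = y.
Proof.
by move=> acL y; apply/(connecting_next_exact ip); exact: acyclic_cohomology.
Qed.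

Lemma connecting_iso n : acyclic_at L n -> acyclic_at L n.+1 ->
  isomorphic (cohomology Q n) (cohomology K n.+1).
Proof.
move=> acL acL'.
apply: (@iso_same_kernel k (cohomology Q n) _ _ idfun (connecting ip n)).
- by move=> x; exists x.
- exact: connecting_surj.
- move=> x /=; split=> [->|/(connecting_exact ip)[y <-]]; first exact: linear0.
  by rewrite (acyclic_cohomology y acL) linear0.
Qed.

(** The first step of dimension shifting: if the cohomology of [L] and [Q] in degree
    [n] is represented by spaces of cocycles [U] and [V], then [H^(n+1)(K)] is the cokernel
    of [U -> V]. *)
Lemma connecting_presentation n (U V : lmodType k) (q : {linear U -> V})
    (gL : U -> L n) (gQ : V -> Q n) :
  acyclic_at L n.+1 ->
  (forall u, cdiff L n (gL u) = 0) ->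
  (forall a, cdiff L n a = 0 -> exists u, gL u = a) ->
  linear gQ -> (forall v, cdiff Q n (gQ v) = 0) ->
  (forall v, is_coboundary (gQ v) -> v = 0) ->
  (forall a, cdiff Q n a = 0 -> exists v, gQ v = a) ->
  (forall u, p n (gL u) = gQ (q u)) ->
  exists s : {linear V -> cohomology K n.+1},
    (forall y, exists v, s v = y) /\ (forall v, s v = 0 <-> exists u, q u = v).
Proof.
move=> acL gLK gL_surj gQ_lin gQK gQ_inj gQ_surj gq.
have [f [h [fK hK fP]]] := cocycle_family_iso gQ_lin gQK gQ_inj gQ_surj.
exists (connecting ip n \o f); split=> [y|v] /=.
  by have [x <-] := connecting_surj acL y; exists (h x); rewrite hK.
split=> [/(connecting_exact ip)[y pyv]|[u <-]].
  have [a ya] := represents_ex y; have [u gu] := gL_surj _ (represents_cocycle ya).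
  exists u; apply: (can_inj fK); rewrite -pyv.
  apply: (represents_coboundary_eq (fP _) (cohomology_mapP p ya)).
  by rewrite -gq gu subrr; exact: coboundary0.
apply/(connecting_exact ip).
have [y yu] := cocycle_represents (gLK u); exists y.
apply: (represents_coboundary_eq (cohomology_mapP p yu) (fP _)).
by rewrite gq subrr; exact: coboundary0.
Qed.

End CohomologyFromCocycles.

Section HomPush.
Context (k : fieldType) (A B : linear_category k).

Definition bhom_push (M N N' : bimodule A B) (w : bimod_hom N N') (u : bimod_hom M N) :=
  bimod_hom_comp w u.

Lemma bhom_push_linear M N N' w : linear (@bhom_push M N N' w).
Proof.
by move=> c u v; apply: bimod_hom_ext => a b m /=; rewrite !addr0 !scale1r bhom_linear.
Qed.
HB.instance Definition _ M N N' w := GRing.isLinear.Build k (bimod_hom M N)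
  (bimod_hom M N') *:%R (@bhom_push M N N' w) (@bhom_push_linear M N N' w).

Lemma bimod_hom_compA (M N P Q : bimodule A B) (w : bimod_hom P Q)
    (v : bimod_hom N P) (u : bimod_hom M N) :
  bimod_hom_comp w (bimod_hom_comp v u) = bimod_hom_comp (bimod_hom_comp w v) u.
Proof. exact: bimod_hom_ext. Qed.

Lemma bimod_hom_factor (M N Q : bimodule A B) (i : bimod_hom N Q) (u : bimod_hom M Q) :
  (forall a b, injective (i a b)) -> (forall a b m, exists n, i a b n = u a b m) ->
  exists v : bimod_hom M N, bimod_hom_comp i v = u.
Proof.
move=> i_inj iu.
pose v a b m := sval (cid (iu a b m)).
have vP a b m : i a b (v a b m) = u a b m := svalP (cid (iu a b m)).
unshelve eexists.
- exists v => [a b c m n|a' a b f m|a b b' m g]; apply: i_inj.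
  + by rewrite bhom_linear !vP bhom_linear.
  + by rewrite bhom_lact !vP bhom_lact.
  + by rewrite bhom_ract !vP bhom_ract.
- by apply: bimod_hom_ext => a b m /=.
Qed.

End HomPush.

(** * Ext as a cohomological functor of the coefficients *)

Section ExtCoefficients.
Context (k : fieldType) (A B : linear_category k) (M : bimodule A B).
Context (P : projective_resolution M).

Section Coefficients.
Context (N : bimodule A B).

Definition ext_aug (v : bimod_hom M N) : ext_complex P N 0 :=
  bimod_hom_comp v (pres_aug P).

Lemma ext_aug_linear : linear ext_aug.
Proof. by move=> c u v; apply: bimod_hom_ext => a b m /=; rewrite !addr0 !scale1r. Qed.

Lemma ext_aug_cocycle v : cdiff (ext_complex P N) 0 (ext_aug v) = 0.
Proof.
apply: bimod_hom_ext => a b m /=.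
have -> : pres_aug P a b (pres_diff P 0 a b m) = 0 by apply/pres_exact0; exists m.
exact: linear_fun0 (bhom_linear v (a:=a) (b:=b)).
Qed.

Lemma ext_aug_inj v : ext_aug v = 0 -> v = 0.
Proof.
move=> v0; apply: bimod_hom_ext => a b m; have [q <-] := pres_aug_surjective P m.
exact: (congr1 (fun f : bimod_hom (P 0) N => f a b q) v0).
Qed.

Lemma ext_aug_surj (u : ext_complex P N 0) :
  cdiff (ext_complex P N) 0 u = 0 -> exists v, ext_aug v = u.
Proof.
move=> du.
have u_ker a b q : pres_aug P a b q = 0 -> u a b q = 0.
  move/pres_exact0 => [q' <-].
  exact: (congr1 (fun f : bimod_hom (P 1) N => f a b q') du).
have u_eq a b q q' : pres_aug P a b q = pres_aug P a b q' -> u a b q = u a b q'.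
  move=> qq'; apply/eqP; rewrite -subr_eq0 -(linear_funB (bhom_linear u (a:=a) (b:=b))).
  by apply/eqP/u_ker; rewrite (linear_funB (bhom_linear _ (a:=a) (b:=b))) qq' subrr.
pose s a b m := sval (cid (pres_aug_surjective P m : exists q, pres_aug P a b q = m)).
have sP a b m : pres_aug P a b (s a b m) = m :=
  svalP (cid (pres_aug_surjective P m : exists q, pres_aug P a b q = m)).
unshelve eexists.
- exists (fun a b m => u a b (s a b m)) => [a b c m n|a' a b f m|a b b' m g].
  + by rewrite -bhom_linear; apply: u_eq; rewrite bhom_linear !sP.
  + by rewrite -bhom_lact; apply: u_eq; rewrite bhom_lact !sP.
  + by rewrite -bhom_ract; apply: u_eq; rewrite bhom_ract !sP.
- by apply: bimod_hom_ext => a b q /=; apply: u_eq; rewrite sP.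
Qed.

End Coefficients.

Definition ext_push N N' (w : bimod_hom N N') :
  chain_map (ext_complex P N) (ext_complex P N').
Proof.
exists (fun n => [the {linear _ -> _} of @bhom_push k A B (P n) N N' w]).
by move=> n u; apply: bimod_hom_ext.
Defined.

Lemma ext_push_short_exact (N N' N'' : bimodule A B)
    (i : bimod_hom N N') (p : bimod_hom N' N'') :
  (forall a b, injective (i a b)) -> bimod_surjective p ->
  (forall a b m, p a b m = 0 <-> exists n, i a b n = m) ->
  short_exact (ext_push i) (ext_push p).
Proof.
move=> i_inj p_surj ip; split=> [n u v uv|n u|n u].
- apply: bimod_hom_ext => a b q; apply: i_inj.
  exact: (congr1 (fun f : bimod_hom (P n) N' => f a b q) uv).
- split=> [pu|[v <-]].
    apply: bimod_hom_factor => // a b q; apply/ip.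
    exact: (congr1 (fun f : bimod_hom (P n) N'' => f a b q) pu).
  by apply: bimod_hom_ext => a b q /=; apply/ip; eexists.
- exact: pres_projective.
Qed.

(** By adjunction a cocycle is a family of linear maps [P n.+1 -> N] that vanish on
    the image of [P n.+2], hence on the kernel of [P n.+1 -> P n]. So it factors
    through linear maps [P n -> N], which in turn correspond to a homomorphism into
    the coinduced bimodule. *)
Lemma ext_coinduced_acyclic (N : bimodule A B) n :
  acyclic_at (ext_complex P (coinduced N)) n.+1.
Proof.
move=> u du.
have ev_lin a b : linear (fun q => coind_eval (u a b q)).
  by move=> c q q'; rewrite bhom_linear coind_eval_linear.
have ext_v a b : exists f : {linear P n a b -> N a b},
    forall q, f (pres_diff P n a b q) = coind_eval (u a b q).
  apply: linear_factor (bhom_linear _ (a:=a) (b:=b)) (ev_lin a b) _ => q.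
  move=> /pres_exact[q' <-].
  have -> : u a b (pres_diff P n.+1 a b q') = 0.
    exact: (congr1 (fun f : bimod_hom (P n.+2) _ => f a b q') du).
  by [].
pose v a b := sval (cid (ext_v a b)).
have vP a b q : v a b (pres_diff P n a b q) = coind_eval (u a b q) :=
  svalP (cid (ext_v a b)) q.
have v_lin a b : linear (v a b) by move=> c q q'; rewrite linearP.
exists (coind_adjunct v_lin).
apply: bimod_hom_ext => a b q; apply: coind_ext => a' b' h l.
by rewrite coind_homE /= -bhom_lact -bhom_ract vP.
Qed.

End ExtCoefficients.

(** * Comparison of Ext with the cohomology of the gluing *)

Section GluingDegreeOne.
Context (k : fieldType) (C1 C2 : linear_category k) (M : bimodule C1 C2).
Let G := gluing M.

Section Coefficients.
Context (X : bimodule C1 C2).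
Let X0 := ext0 M X.

(** [ext0 X] vanishes on the diagonal. *)
Lemma ext0_cochain0 (F : hm_complex X0 0) : F = 0.
Proof.
apply: cochain_ext => y x e; case: _ / e.
by case: y => y; exact: rV0_eq.
Qed.

Section Cochain.
Context (u : bimod_hom M X).

(** A one-cochain of the gluing with values in [ext0 X] is a family of linear maps
    [M a b -> X a b], the other morphism spaces contributing nothing. The cocycle
    condition says that it is a derivation, that is, compatible with both actions. *)
Definition bhom_hom (y w : G) : hom G y w -> X0 y w :=
  match y as y0, w as w0 return hom G y0 w0 -> X0 y0 w0 with
  | inl a, inr b => u a b
  | _, _ => fun _ => 0
  end.

Lemma bhom_hom_linear y w : linear (@bhom_hom y w).
Proof.
case: y w => y [] w c f g /=; rewrite ?scaler0 ?addr0 //; exact: bhom_linear.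
Qed.

Definition bhom_cochain_fun (y x : G) (c : chain 1 y x) : X0 y x :=
  let: existT w (f, e) := c in
  match e in _ = z return X0 y z with erefl => bhom_hom f end.

Lemma bhom_cochain_multilinear y x : multilinear (@bhom_cochain_fun y x).
Proof. by split=> // w c; case: _ / c => a f g; exact: bhom_hom_linear. Qed.

Definition bhom_cochain : hm_complex X0 1 := Cochain bhom_cochain_multilinear.

Lemma bhom_cochain_cocycle : cdiff (hm_complex X0) 1 bhom_cochain = 0.
Proof.
apply: cochain_ext => y x c.
elim/chainS_ind: c => w f c; elim/chainS_ind: c => v g e; case: _ / e.
apply: (etrans (hm_diffE bhom_cochain f (ccons g (erefl : chain 0 v v)))).
rewrite hm_tailS hm_tail0 /= opprK.
case: y w v f g => y [] w [] v f g /=; rewrite ?oppr0 ?addr0 //.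
- by rewrite bhom_lact addrN.
- by rewrite bhom_ract add0r addNr.
Qed.

End Cochain.

Lemma bhom_cochain_linear : linear bhom_cochain.
Proof.
move=> c u v; apply: cochain_ext => y x ch.
elim/chainS_ind: ch => w f e; case: _ / e => /=.
case: y w f => y [] w f /=; rewrite ?scaler0 ?addr0 //.
by rewrite !scale1r.
Qed.

Lemma bhom_cochain_inj u : is_coboundary (bhom_cochain u) -> u = 0.
Proof.
move=> [F uF]; apply: bimod_hom_ext => a b m.
rewrite (ext0_cochain0 F) linear0 in uF.
exact: (congr1 (fun f : cochain X0 1 => f (inl a) (inr b)
  (ccons (m : hom G (inl a) (inr b)) (erefl : chain 0 (inr b : G) _))) uF).
Qed.

Lemma bhom_cochain_surj (F : hm_complex X0 1) :
  cdiff (hm_complex X0) 1 F = 0 -> exists u, bhom_cochain u = F.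
Proof.
move=> dF.
pose v (y x : G) (f : hom G y x) : X0 y x := F y x (ccons f (erefl : chain 0 x x)).
have v_lin (y x : G) : linear (@v y x).
  by move=> c f g; have [p1 _] := cochain_multilinear F y x; exact: p1.
have v_der (y w x : G) (f : hom G y w) (g : hom G w x) :
    lact X0 f (v w x g) - v y x (comp f g) + ract X0 (v y w f) g = 0.
  have := hm_diffE F f (ccons g (erefl : chain 0 x x)).
  by rewrite [hm_diff F]dF hm_tailS hm_tail0 opprK addrA => <-.
unshelve eexists.
- exists (fun a b (m : M a b) => v (inl a) (inr b) m) => [a b|a' a b f m|a b b' m g].
  + exact: (v_lin (inl a) (inr b)).
  + have := v_der (inl a') (inl a) (inr b) f m.
    by rewrite /= addr0 => /eqP; rewrite subr_eq0 => /eqP <-.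
  + have := v_der (inl a) (inr b) (inr b') m g.
    by rewrite /= sub0r addrC => /eqP; rewrite subr_eq0 => /eqP <-.
- apply: cochain_ext => y x c; elim/chainS_ind: c => w f e; case: _ / e.
  by case: y w f => y [] w f; try exact: rV0_eq.
Qed.

Lemma hom_iso_HM1 : isomorphic (bimod_hom M X) (HM X0 1).
Proof.
have [f [h [fK hK _]]] := cocycle_family_iso bhom_cochain_linear
  bhom_cochain_cocycle bhom_cochain_inj bhom_cochain_surj.
by exists f, h.
Qed.

End Coefficients.

Lemma bhom_cochain_push (X Y : bimodule C1 C2) (w : bimod_hom X Y) (u : bimod_hom M X) :
  hm_bhom (ext0_bhom M w) 1 (bhom_cochain u) = bhom_cochain (bhom_push w u).
Proof.
apply: cochain_ext => y x c; elim/chainS_ind: c => v f e; case: _ / e.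
by case: y v f => y [] v f /=.
Qed.

End GluingDegreeOne.

Section Comparison.
Context (k : fieldType) (C1 C2 : linear_category k) (M : bimodule C1 C2).
Context (P : projective_resolution M).

Section Shift.
Context (X : bimodule C1 C2).
Let X' := coinduced X.
Let i := coind_unit X.
Let r := @coind_eval k C1 C2 X.
Let r_lin : forall a b, linear (@r a b) := @coind_eval_linear k C1 C2 X.
Let rK : forall a b m, r (i a b m) = m := @coind_unitK k C1 C2 X.
Definition coind_coker : bimodule C1 C2 := split_coker r_lin rK.
Definition coind_quot : bimod_hom X' coind_coker := split_coker_quot r_lin rK.

Lemma coind_unit_inj a b : injective (i a b).
Proof. exact: can_inj (@rK a b). Qed.

Lemma coind_quot_eq0 a b m : coind_quot a b m = 0 <-> exists n, i a b n = m.
Proof. exact: split_coker_proj_eq0. Qed.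

Lemma coind_ext_short_exact : short_exact (ext_push P i) (ext_push P coind_quot).
Proof.
apply: ext_push_short_exact coind_unit_inj _ coind_quot_eq0 => a b m.
by exists (split_coker_val m); exact: split_coker_projK.
Qed.

Lemma coind_hm_short_exact :
  short_exact (hm_bhom (ext0_bhom M i)) (hm_bhom (ext0_bhom M coind_quot)).
Proof.
apply: (@hm_bhom_short_exact k _ _ _ _ _ _
  (fun y x => match y as y0, x as x0
     return ext0 M X' y0 x0 -> ext0 M X y0 x0 with
     | inl a, inr b => @r a b | _, _ => fun _ => 0 end)
  (fun y x => match y as y0, x as x0
     return ext0 M coind_coker y0 x0 -> ext0 M X' y0 x0 with
     | inl a, inr b => fun m => split_coker_val m | _, _ => fun _ => 0 end)).
- by case=> y [] x; try (by move=> c m n; rewrite /= scaler0 addr0); exact: (@r_lin y x).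
- by case=> y [] x c m n //=; rewrite ?scaler0 ?addr0.
- case=> y [] x m; try exact: rV0_eq; exact: rK.
- case=> y [] x m; try exact: rV0_eq; exact: split_coker_projK.
- case=> y [] x m; try (split=> _; [exists 0|]; exact: rV0_eq).
  exact: coind_quot_eq0.
Qed.

Lemma hm_coinduced_acyclic n : acyclic_at (hm_complex (ext0 M X')) n.+2.
Proof. exact: ext0_coinduced_acyclic. Qed.

End Shift.

(** Induction on [n], passing from [X] to the cokernel of its embedding in a
    coinduced bimodule. In degree one both sides are the cokernel of
    [Hom(M, X') -> Hom(M, X'')]; later the connecting maps are isomorphisms. *)
Lemma Ext_iso_HM n (X : bimodule C1 C2) : isomorphic (Ext P X n) (HM (ext0 M X) n.+1).
Proof.
elim: n X => [|n IHn] X.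
  apply: iso_trans (hom_iso_HM1 M X).
  have [f [h [fK hK _]]] := cocycle_family_iso (@ext_aug_linear k C1 C2 M P X)
    (@ext_aug_cocycle k C1 C2 M P X) (@ext_aug_inj k C1 C2 M P X)
    (@ext_aug_surj k C1 C2 M P X).
  by exists h, f.
case: n IHn => [_|n IHn]; last first.
  apply: iso_trans (iso_trans (IHn (coind_coker X)) _).
    apply/iso_sym/(connecting_iso (coind_ext_short_exact X));
      exact: ext_coinduced_acyclic.
  apply: (connecting_iso (coind_hm_short_exact X)); exact: hm_coinduced_acyclic.
have [s [s_surj s_ker]] := connecting_presentation (coind_ext_short_exact X)
  (q := @bhom_push k C1 C2 M _ _ (coind_quot X)) (@ext_coinduced_acyclic k C1 C2 M P X 0)
  (@ext_aug_cocycle k C1 C2 M P _) (@ext_aug_surj k C1 C2 M P _)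
  (@ext_aug_linear k C1 C2 M P _) (@ext_aug_cocycle k C1 C2 M P _)
  (@ext_aug_inj k C1 C2 M P _) (@ext_aug_surj k C1 C2 M P _)
  (fun u => bimod_hom_compA _ _ _).
have [t [t_surj t_ker]] := connecting_presentation (coind_hm_short_exact X)
  (q := @bhom_push k C1 C2 M _ _ (coind_quot X)) (@hm_coinduced_acyclic X 0)
  (@bhom_cochain_cocycle k C1 C2 M _) (@bhom_cochain_surj k C1 C2 M _)
  (@bhom_cochain_linear k C1 C2 M _) (@bhom_cochain_cocycle k C1 C2 M _)
  (@bhom_cochain_inj k C1 C2 M _) (@bhom_cochain_surj k C1 C2 M _)
  (@bhom_cochain_push k C1 C2 M _ _ _).
by apply: (iso_same_kernel s_surj t_surj) => u; split=> [/s_ker/t_ker|/t_ker/s_ker].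
Qed.

End Comparison.

(** * The long exact sequence *)

Section Transport.
Context (k : fieldType).

Lemma iso_family (V W : nat -> lmodType k) : (forall n, isomorphic (V n) (W n)) ->
  exists (f : forall n, {linear V n -> W n}) (g : forall n, {linear W n -> V n}),
    (forall n, cancel (f n) (g n)) /\ (forall n, cancel (g n) (f n)).
Proof.
move=> /(_ _)/cid VW; exists (fun n => sval (VW n)).
have /(_ _)/cid gP n := svalP (VW n).
by exists (fun n => sval (gP n)); split=> n; case: (svalP (gP n)).
Qed.

Lemma exact_at_iso_mid (U V V' W : lmodType k) (f : {linear U -> V}) (g : {linear V -> W})
    (j : {linear V -> V'}) (j' : {linear V' -> V}) :
  cancel j j' -> cancel j' j -> exact_at f g -> exact_at (j \o f) (g \o j').
Proof.
move=> jK j'K fg v /=; split=> [/fg[u fu]|[u <-]]; first by exists u; rewrite fu.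
by rewrite jK; apply/fg; exists u.
Qed.

Lemma exact_at_iso_left (U U' V W : lmodType k)
    (f : {linear U -> V}) (g : {linear V -> W})
    (j : {linear U -> U'}) (j' : {linear U' -> U}) :
  cancel j j' -> exact_at f g -> exact_at (f \o j') g.
Proof.
move=> jK fg v; split=> [/fg[u fu]|[u <-]]; last by apply/fg; exists (j' u).
by exists (j u); rewrite /= jK.
Qed.

Lemma exact_at_iso_right (U V W W' : lmodType k)
    (f : {linear U -> V}) (g : {linear V -> W})
    (j : {linear W -> W'}) :
  injective j -> exact_at f g -> exact_at f (j \o g).
Proof.
move=> j_inj fg v; split=> [/= gv|[u fu]].
  by apply/fg/j_inj; rewrite gv linear0.
by rewrite /= (_ : g v = 0) ?linear0 //; apply/fg; exists u.
Qed.

End Transport.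

Theorem theorem4p4 (k : fieldType) (C1 C2 : linear_category k)
    (M : bimodule C1 C2) (N : bimodule (gluing M) (gluing M))
    (P : projective_resolution M) :
  exists (alpha : forall n, {linear HM N n -> (HM (r1 N) n * HM (r2 N) n)%type})
         (beta0 : {linear (HM (r1 N) 0 * HM (r2 N) 0)%type -> bimod_hom M (r12 N)})
         (delta0 : {linear bimod_hom M (r12 N) -> HM N 1})
         (beta : forall n, {linear (HM (r1 N) n.+1 * HM (r2 N) n.+1)%type ->
                              Ext P (r12 N) n.+1})
         (delta : forall n, {linear Ext P (r12 N) n.+1 -> HM N n.+2}),
    [/\ injective (alpha 0%N),
        exact_at (alpha 0%N) beta0,
        exact_at beta0 delta0
      & exact_at delta0 (alpha 1%N)] /\
    (forall n, [/\ exact_at (alpha n.+1) (beta n),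
                   exact_at (beta n) (delta n)
                 & exact_at (delta n) (alpha n.+2)]).
Proof.
have ses := gluing_short_exact N.
have [a [a' [aK a'K]]] :=
  iso_family (prod_complex_iso (hm_complex (r1 N)) (hm_complex (r2 N))).
have [e [e' [eK e'K]]] := iso_family (fun n => Ext_iso_HM P n.+1 (r12 N)).
have [h [h' [hK h'K]]] := hom_iso_HM1 M (r12 N).
pose i_ n := cohomology_map (hm_bhom (ext0_incl N)) n.
pose p_ n := cohomology_map (glue_restrict N) n.
pose d_ n := connecting ses n.
exists (fun n => a n \o p_ n), (h' \o (d_ 0 \o a' 0)), (i_ 1 \o h),
  (fun n => e' n \o (d_ n.+1 \o a' n.+1)), (fun n => i_ n.+2 \o e n).
have ip n : exact_at (i_ n) (p_ n) by exact: cohomology_map_exact.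
have pd n : exact_at (p_ n) (d_ n) by exact: connecting_exact.
have di n : exact_at (d_ n) (i_ n.+1) by exact: connecting_next_exact.
have alpha_exact n : exact_at (a n \o p_ n) (d_ n \o a' n) by exact: exact_at_iso_mid.
have delta_exact n : exact_at (d_ n \o a' n) (i_ n.+1) by exact: exact_at_iso_left.
split=> [|n]; split.
- move=> x y /= /(can_inj (aK 0)) pxy; apply/eqP; rewrite -subr_eq0; apply/eqP.
  have /ip[z <-] : p_ 0 (x - y) = 0 by rewrite linearB pxy subrr.
  have [b zb] := represents_ex z.
  suff -> : z = 0 by rewrite linear0.
  by apply/(represents_eq0 zb); exact: ext0_cochain0.
- exact: exact_at_iso_right (can_inj h'K) (alpha_exact 0).
- exact: exact_at_iso_mid h'K hK (delta_exact 0).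
- exact/(exact_at_iso_right (can_inj (aK 1)))/(exact_at_iso_left h'K)/ip.
- exact: exact_at_iso_right (can_inj (e'K n)) (alpha_exact n.+1).
- exact: exact_at_iso_mid (e'K n) (eK n) (delta_exact n.+1).
- exact/(exact_at_iso_right (can_inj (aK n.+2)))/(exact_at_iso_left (e'K n))/ip.
Qed.
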